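(* Let $E$ be a Banach lattice satisfying Assumption (A) (stated in the context), and let $G \subset \mathrm{ZAut}^+_s(E)\cdot \mathrm{IAut}^+_s(E)$ be a compact group. Then there exist a unique compact group $H \subset \mathrm{IAut}^+_s(E)$ and an $m \in \mathrm{ZAut}^+(E)$ such that \[ G = mHm^{-1}. \] Conversely, if $H \subset \mathrm{IAut}^+_s(E)$ is a compact subgroup and $m \in \mathrm{ZAut}^+(E)$, then $G := mHm^{-1}$ is a compact subgroup of $\mathrm{ZAut}^+_s(E)\cdot \mathrm{IAut}^+_s(E)$.
   Context: Banach lattices are real. $\mathrm{Aut}^+(E)$ is the group of lattice automorphisms of $E$ (these are automatically bounded), and $\mathrm{IAut}^+(E)$ is the subgroup of isometric lattice automorphisms. The center $Z(E)$ is the set of regular operators $m$ on $E$ with $-\lambda I \le m \le \lambda I$ for some $\lambda \ge 0$, and $\mathrm{ZAut}^+(E) := \mathrm{Aut}^+(E)\cap Z(E)$ is the group of central lattice automorphisms. The subscript $s$ (as in $\mathrm{IAut}^+_s(E)$, $\mathrm{ZAut}^+_s(E)$, $\mathrm{ZAut}^+_s(E)\cdot\mathrm{IAut}^+_s(E)$) indicates that the set is equipped with the strong operator topology; compactness is with respect to this topology. The set $\mathrm{ZAut}^+(E)\cdot \mathrm{IAut}^+(E) = \{m\phi : m \in \mathrm{ZAut}^+(E), \phi \in \mathrm{IAut}^+(E)\}$ is a subgroup of $\mathrm{Aut}^+(E)$, the factorization $m\phi$ of each of its elements is unique, and $p(m\phi) := \phi$ defines a group homomorphism $p$ from it onto $\mathrm{IAut}^+(E)$.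 Assumption (A) on $E$: for every compact subgroup $G \subset \mathrm{ZAut}^+_s(E)\cdot \mathrm{IAut}^+_s(E)$, the restriction $p|_G \colon G \to \mathrm{IAut}^+_s(E)$ is continuous. *)

(* Defs.v *)
From HB Require Import structures.
From mathcomp Require Import all_boot all_order all_algebra.
From mathcomp Require Import all_classical all_reals all_analysis.

Set Implicit Arguments.
Unset Strict Implicit.
Unset Printing Implicit Defensive.

Import Order.TTheory GRing.Theory Num.Theory.
Import numFieldNormedType.Exports.

Local Open Scope classical_set_scope.
Local Open Scope ring_scope.

(* The order is a field of the mixin instead of coming from Order.Lattice:
   Hierarchy Builder rejects a common subclass of NormedModule and
   Order.Lattice, for lack of joins below Num.RealDomain. *)
HB.mixin Record isBanachLattice (R : realType) E
    of CompleteNormedModule R E := {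
  vle : E -> E -> Prop ;
  vjoin : E -> E -> E ;
  vmeet : E -> E -> E ;
  vle_refl : forall x, vle x x ;
  vle_trans : forall y x z, vle x y -> vle y z -> vle x z ;
  vle_anti : forall x y, vle x y -> vle y x -> x = y ;
  vle_joinP : forall x y z, vle (vjoin x y) z <-> vle x z /\ vle y z ;
  vle_meetP : forall x y z, vle z (vmeet x y) <-> vle z x /\ vle z y ;
  vle_add2r : forall z x y, vle x y -> vle (x + z) (y + z) ;
  vle_scale_ge0 : forall (a : R) x, 0 <= a -> vle 0 x -> vle 0 (a *: x) ;
  vle_norm : forall x y, vle (vjoin x (- x)) (vjoin y (- y)) -> `|x| <= `|y|
}.

#[short(type="banachLatticeType")]
HB.structure Definition BanachLattice (R : realType) :=
  {E of CompleteNormedModule R E & isBanachLattice R E}.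

Section Operators.
Context {R : realType} (E : banachLatticeType R).

Definition positive_op (T : E -> E) : Prop :=
  linear T /\ forall x : E, vle 0 x -> vle 0 (T x).

Definition regular_op (T : E -> E) : Prop :=
  exists T1 T2 : E -> E,
    [/\ positive_op T1, positive_op T2 & forall x, T x = T1 x - T2 x].

Definition le_op (S T : E -> E) : Prop :=
  forall x : E, vle 0 x -> vle (S x) (T x).

Definition op_center : set (E -> E) :=
  [set m | regular_op m /\
    exists lambda : R, [/\ 0 <= lambda,
      le_op (fun x => - (lambda *: x)) m & le_op m (fun x => lambda *: x)]].

Definition AutP : set (E -> E) :=
  [set f | [/\ linear f, bijective f,
              {morph f : x y / vjoin x y} & {morph f : x y / vmeet x y}]].

Definition IAutP : set (E -> E) :=
  AutP `&` [set f | forall x : E, `|f x| = `|x|].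

Definition ZAutP : set (E -> E) := AutP `&` op_center.

Definition ZIAutP : set (E -> E) :=
  [set f | exists m phi, [/\ ZAutP m, IAutP phi & f = m \o phi]].

(* Every f in ZIAutP has exactly one such phi; id is a dummy value outside. *)
Definition isometric_part (f : {ptws E -> E}) : {ptws E -> E} :=
  xget (id : {ptws E -> E}) [set phi | IAutP phi /\ exists2 m, ZAutP m & f = m \o phi].

Definition group_of_maps (G : set (E -> E)) : Prop :=
  [/\ G id,
      forall f g, G f -> G g -> G (f \o g)
    & forall f, G f -> exists2 g, G g & cancel f g /\ cancel g f].

(* On sets of bounded operators the strong operator topology is the trace of
   the topology of pointwise convergence on {ptws E -> E}. *)
Definition compact_subgroup (G A : set (E -> E)) : Prop :=
  [/\ group_of_maps G, G `<=` A & compact (G : set {ptws E -> E})].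

Definition assumptionA : Prop :=
  forall G : set (E -> E), compact_subgroup G ZIAutP ->
    {within (G : set {ptws E -> E}), continuous isometric_part}.

(* For bijective m, pinv setT m is the two-sided inverse of m. *)
Definition conj_set (m : E -> E) (H : set (E -> E)) : set (E -> E) :=
  [set m \o h \o pinv setT m | h in H].

End Operators.

Arguments op_center {R} E _.
Arguments AutP {R} E _.
Arguments IAutP {R} E _.
Arguments ZAutP {R} E _.
Arguments ZIAutP {R} E _.

(* Main.v *)
Require Import Defs.
From HB Require Import structures.
From mathcomp Require Import all_boot all_order all_algebra.
From mathcomp Require Import all_classical all_reals all_analysis.
From mathcomp Require Import perm ring lra.

(* For g = m_g p(g) in G, with central part m_g = g p(g)^-1, the operator m is
   the Haar mean over G of g |-> m_g, taken pointwise in E. Since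
   m_(gh) = g m_h p(g)^-1, invariance of the mean gives g m p(g)^-1 = m, that is
   g = m p(g) m^-1, and so H = p(G). Compactness makes G uniformly bounded, say
   by C, hence m_g and m lie between C^-1 and C, which makes m a central lattice
   automorphism. H is unique because p (m h m^-1) = h.

   The mean is built by hand. For f(g) = m_g x the bi-invariant pseudometric
   sup_(a, b) |f(a g b) - f(a k b)| is totally bounded, by Assumption (A). If
   (k_i) is an e-net with n points, averaging right translates over it brings
   the oscillation of f from e + d down to e + (1 - 1/n) d. Right and left
   averages have the same limit, as is seen by averaging on both sides. *)

Set Implicit Arguments.
Unset Strict Implicit.
Unset Printing Implicit Defensive.

Import Order.TTheory GRing.Theory Num.Theory.
Import numFieldNormedType.Exports.

Local Open Scope classical_set_scope.
Local Open Scope ring_scope.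

(** * Vector lattices *)

Section VectorLattice.
Context {R : realType} (E : banachLatticeType R).
Implicit Types (x y z u v w : E) (a b c : R).

Local Notation "x <=v y" := (vle x y) (at level 70).
Local Notation "x \/v y" := (vjoin x y) (at level 50).
Local Notation "x /\v y" := (vmeet x y) (at level 48).
Local Notation pos x := (vjoin x 0).
Local Notation neg x := (vjoin (- x) 0).
Local Notation abs x := (vjoin x (- x)).

(** The central parts are controlled only pointwise in [E], so the mean is formed for each vector
    separately and none of its properties as an operator is automatic. Linearity needs weights that
    serve two functions at once; the relation with [g] needs uniqueness of the mean. That the mean
    is again a lattice automorphism is the main obstacle, since an average of lattice homomorphisms
    need not be one. What survives averaging is a two-sided order bound, and a linear map between
    two positive multiples of the identity is a central lattice automorphism
    ([linop_between_ZAutP]). Compactness provides norm bounds only. The passage from norm to order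
    is [ZAutP_can_le]: if the inverse of a central automorphism has norm at most [c], it is at most
    [c] on the cone. This is proved inside the vector lattice, without representing its elements as
    functions, and it also shows that a central isometry is the identity, on which uniqueness of the
    factorization rests. *)

Lemma vle_tr y x z : x <=v y -> y <=v z -> x <=v z.
Proof. exact: vle_trans. Qed.

Lemma vle_joinl x y : x <=v x \/v y.
Proof. by have /vle_joinP[] := vle_refl (x \/v y). Qed.

Lemma vle_joinr x y : y <=v x \/v y.
Proof. by have /vle_joinP[] := vle_refl (x \/v y). Qed.

Lemma vle_meetl x y : x /\v y <=v x.
Proof. by have /vle_meetP[] := vle_refl (x /\v y). Qed.

Lemma vle_meetr x y : x /\v y <=v y.
Proof. by have /vle_meetP[] := vle_refl (x /\v y). Qed.

Lemma vjoin_le x y z : x <=v z -> y <=v z -> x \/v y <=v z.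
Proof. by move=> xz yz; apply/vle_joinP. Qed.

Lemma vmeet_ge x y z : z <=v x -> z <=v y -> z <=v x /\v y.
Proof. by move=> xz yz; apply/vle_meetP. Qed.

Lemma vjoinC x y : x \/v y = y \/v x.
Proof.
by apply: vle_anti; apply: vjoin_le; (exact: vle_joinl || exact: vle_joinr).
Qed.

Lemma vmeetC x y : x /\v y = y /\v x.
Proof.
by apply: vle_anti; apply: vmeet_ge; (exact: vle_meetl || exact: vle_meetr).
Qed.

Lemma vjoin_idr x y : x <=v y -> x \/v y = y.
Proof.
move=> xy; apply: vle_anti; last exact: vle_joinr.
by apply: vjoin_le => //; exact: vle_refl.
Qed.

Lemma vjoin_homo x y z w : x <=v z -> y <=v w -> x \/v y <=v z \/v w.
Proof.
move=> xz yw; apply: vjoin_le.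
  by apply: vle_tr xz _; exact: vle_joinl.
by apply: vle_tr yw _; exact: vle_joinr.
Qed.

Lemma vmeet_homo x y z w : x <=v z -> y <=v w -> x /\v y <=v z /\v w.
Proof.
move=> xz yw; apply: vmeet_ge.
  by apply: vle_tr xz; exact: vle_meetl.
by apply: vle_tr yw; exact: vle_meetr.
Qed.

Lemma vsubr_ge0 x y : 0 <=v y - x <-> x <=v y.
Proof.
split=> [/(vle_add2r x)|/(vle_add2r (- x))]; last by rewrite subrr.
by rewrite add0r subrK.
Qed.

Lemma vle_subr_addr x y z : x <=v y - z <-> x + z <=v y.
Proof. by rewrite -vsubr_ge0 -[_ <=v y]vsubr_ge0 opprD addrAC addrA. Qed.

Lemma vle_subl_addr x y z : x - z <=v y <-> x <=v y + z.
Proof. by rewrite -vsubr_ge0 -[x <=v _]vsubr_ge0 opprB [z - x]addrC addrAC addrA. Qed.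

Lemma vle_add x y z w : x <=v y -> z <=v w -> x + z <=v y + w.
Proof.
move=> xy zw; apply: (@vle_tr (y + z)); first exact: vle_add2r.
by rewrite ![y + _]addrC; exact: vle_add2r.
Qed.

Lemma vaddr_ge0 x y : 0 <=v x -> 0 <=v y -> 0 <=v x + y.
Proof. by move=> x0 y0; have := vle_add x0 y0; rewrite addr0. Qed.

Lemma vle_addl x y : 0 <=v y -> x <=v x + y.
Proof. by move=> y0; apply/vsubr_ge0; rewrite addrAC subrr add0r. Qed.

Lemma vle_oppr x y : - x <=v - y <-> y <=v x.
Proof. by rewrite -vsubr_ge0 -[y <=v x]vsubr_ge0 opprK addrC. Qed.

Lemma vle_scale a x y : 0 <= a -> x <=v y -> a *: x <=v a *: y.
Proof.
move=> a0 /vsubr_ge0 xy; apply/vsubr_ge0.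
by rewrite -scalerBr; exact: vle_scale_ge0.
Qed.

Lemma vle_scaler a b x : a <= b -> 0 <=v x -> a *: x <=v b *: x.
Proof.
move=> ab x0; apply/vsubr_ge0; rewrite -scalerBl.
by apply: vle_scale_ge0; rewrite ?subr_ge0.
Qed.

Lemma vle_scalel a x y : 0 < a -> a^-1 *: x <=v y <-> x <=v a *: y.
Proof.
move=> a0; split=> [/(vle_scale (ltW a0))|].
  by rewrite scalerA mulfV ?gt_eqF// scale1r.
have ai0 : 0 <= a^-1 by rewrite invr_ge0 ltW.
by move=> /(vle_scale ai0); rewrite scalerA mulVf ?gt_eqF// scale1r.
Qed.

Lemma vjoinDr x y z : (x \/v y) + z = (x + z) \/v (y + z).
Proof.
apply: vle_anti; last first.
  by apply: vjoin_le; apply: vle_add2r; [exact: vle_joinl|exact: vle_joinr].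
apply/vle_subr_addr; apply: vjoin_le; apply/vle_subr_addr.
  exact: vle_joinl.
exact: vle_joinr.
Qed.

Lemma vmeetE x y : x /\v y = - ((- x) \/v (- y)).
Proof.
apply: vle_anti.
  apply/vle_oppr; rewrite opprK; apply: vjoin_le; apply/vle_oppr.
    exact: vle_meetl.
  exact: vle_meetr.
apply: vmeet_ge; apply/vle_oppr; rewrite opprK; [exact: vle_joinl|exact: vle_joinr].
Qed.

Lemma vmeetDr x y z : (x /\v y) + z = (x + z) /\v (y + z).
Proof. by rewrite !vmeetE !opprD -vjoinDr opprD opprK. Qed.

Lemma vjoinDmeet x y : (x \/v y) + (x /\v y) = x + y.
Proof.
rewrite vmeetE; apply/eqP; rewrite subr_eq addrC vjoinDr.
by rewrite addKr [x + y]addrC addKr vjoinC.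
Qed.

Lemma vscale_join a x y : 0 < a -> a *: (x \/v y) = (a *: x) \/v (a *: y).
Proof.
move=> a0; apply: vle_anti; last first.
  by apply: vjoin_le; apply: vle_scale; rewrite ?ltW//;
    [exact: vle_joinl|exact: vle_joinr].
rewrite -{1}[a]invrK; apply/vle_scalel; rewrite ?invr_gt0//.
apply: vjoin_le; rewrite -1?[_ <=v _]vle_scalel ?invr_gt0// invrK.
  exact: vle_joinl.
exact: vle_joinr.
Qed.

(** Distributivity comes from the group structure: [vjoinDmeet] turns the meet of [x] and [w] into
    [x + w] minus their join, and for [w] equal to [y] or [z] this join is below that of all three
    vectors. *)
Lemma vmeet_distr x y z : x /\v (y \/v z) <=v (x /\v y) \/v (x /\v z).
Proof.
set t := _ \/v (x /\v z).
have yz : y \/v z <=v t + ((x \/v (y \/v z)) - x).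
  have ge w : w <=v y \/v z -> x /\v w <=v t -> w <=v t + ((x \/v (y \/v z)) - x).
    move=> wyz xwt; rewrite addrA; apply/vle_subr_addr.
    rewrite [w + x]addrC -vjoinDmeet addrC; apply: vle_add => //.
    by apply: vjoin_homo => //; exact: vle_refl.
  apply: vjoin_le; apply: ge; do ?[exact: vle_joinl|exact: vle_joinr].
have e : x /\v (y \/v z) = x + (y \/v z) - (x \/v (y \/v z)).
  by rewrite -(vjoinDmeet x) addrAC subrr add0r.
rewrite e; apply/vle_subl_addr; rewrite addrC; apply/vle_subr_addr.
by rewrite -addrA.
Qed.

Lemma vmeet_distrW u x y z :
  u /\v x <=v z -> u /\v y <=v z -> u /\v (x \/v y) <=v z.
Proof. by move=> ux uy; apply: vle_tr (vmeet_distr _ _ _) _; exact: vjoin_le. Qed.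

Lemma vpos_ge0 x : 0 <=v pos x.
Proof. exact: vle_joinr. Qed.

Lemma vpos_ge x : x <=v pos x.
Proof. exact: vle_joinl. Qed.

Lemma vposBneg x : pos x - neg x = x.
Proof. by have := vjoinDmeet x 0; rewrite vmeetE oppr0 addr0. Qed.

Lemma vpos_meet_neg x : pos x /\v neg x = 0.
Proof.
rewrite -{1}[pos x](subrK (neg x)) vposBneg -[X in _ /\v X]add0r -vmeetDr.
by rewrite vmeetE oppr0 addNr.
Qed.

Lemma vabsE x : abs x = pos x + neg x.
Proof.
have -> : abs x = ((x + x) \/v 0) - x by rewrite vjoinDr addrK add0r.
have -> : (x + x) \/v 0 = pos x + pos x.
  have := @vscale_join 2 x 0 (ltr0Sn _ 1); rewrite scaler0.
  by rewrite !scaler_nat !mulr2n.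
by rewrite -[X in _ - X]vposBneg opprB addrA addrAC addrK.
Qed.

Lemma vabs_ge0 x : 0 <=v abs x.
Proof. by rewrite vabsE; apply: vaddr_ge0; exact: vpos_ge0. Qed.

Lemma vabs_ge x : x <=v abs x.
Proof. exact: vle_joinl. Qed.

Lemma vabs_pos x : 0 <=v x -> abs x = x.
Proof.
move=> x0; rewrite vjoinC vjoin_idr//; apply: (vle_tr _ x0).
by rewrite -oppr0; apply/vle_oppr.
Qed.

Lemma vabs_le x y : x <=v y -> - x <=v y -> abs x <=v y.
Proof. exact: vjoin_le. Qed.

Lemma vpos_le_abs x : pos x <=v abs x.
Proof. by apply: vjoin_le; [exact: vabs_ge|exact: vabs_ge0]. Qed.

Lemma vnorm_abs x : `|abs x| = `|x|.
Proof.
by apply/eqP; rewrite eq_le; apply/andP; split; apply: vle_norm;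
  rewrite [abs (abs x)]vabs_pos; do ?[exact: vabs_ge0|exact: vle_refl].
Qed.

Lemma vnorm_abs_le x y : abs x <=v y -> `|x| <= `|y|.
Proof.
move=> xy; apply: vle_norm; rewrite [abs y]vabs_pos//.
by apply: vle_tr xy; exact: vabs_ge0.
Qed.

Lemma vnorm_le x y : 0 <=v x -> x <=v y -> `|x| <= `|y|.
Proof. by move=> x0 xy; apply: vnorm_abs_le; rewrite vabs_pos. Qed.

(* Any [v >= y] satisfies [(y - x)^+ <= |v - x|]. *)
Lemma vle_closed x y :
  (forall e, 0 < e -> exists2 v, y <=v v & `|v - x| <= e) -> y <=v x.
Proof.
move=> h; suff p0 : pos (y - x) = 0.
  by apply/vsubr_ge0; rewrite -[x - y]opprB -oppr0; apply/vle_oppr;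
    rewrite -p0; exact: vpos_ge.
apply/eqP; rewrite -normr_le0; apply/ler_addgt0Pr => e e0; rewrite add0r.
have [v yv ve] := h e e0; apply: le_trans ve.
rewrite -[leRHS]vnorm_abs; apply: vnorm_le; first exact: vpos_ge0.
apply: vle_tr (vpos_le_abs _); apply: vjoin_homo; last exact: vle_refl.
exact: vle_add2r.
Qed.

Lemma vle_closedl x y :
  (forall e, 0 < e -> exists2 v, v <=v y & `|v - x| <= e) -> x <=v y.
Proof.
move=> h; apply/vle_oppr; apply: vle_closed => e /h[v vy ve].
exists (- v); first exact/vle_oppr.
by rewrite -opprD normrN.
Qed.

Lemma vle_scale_closed a x y : (forall b, a < b -> x <=v b *: y) -> x <=v a *: y.
Proof.
move=> h; apply: vle_closed => e e0.
have y1 : 0 < `|y| + 1 by rewrite ltr_wpDl.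
exists ((a + e / (`|y| + 1)) *: y).
  by apply: h; rewrite ltrDl divr_gt0.
rewrite scalerDl addrAC subrr add0r normrZ gtr0_norm ?divr_gt0//.
by rewrite mulrAC ler_pdivrMr// ler_wpM2l ?(ltW e0)// lerDl.
Qed.

(** The Archimedean property: the order is norm closed by [vle_closed], and [y / n] tends to 0 in
    norm. *)
Lemma vle_archi x y : (forall n : nat, x <=v (n.+1%:R^-1 : R) *: y) -> x <=v 0.
Proof.
move=> h; apply: vle_closed => e e0.
have [n _ hn] : exists2 n, True & `|y| / e < n.+1%:R :> R.
  exists (Num.truncn (`|y| / e)) => //; exact: truncnS_gt.
exists (n.+1%:R^-1 *: y) => //.
rewrite subr0 normrZ gtr0_norm ?invr_gt0//.
by rewrite ler_pdivrMl// mulrC -ler_pdivrMl// mulrC ltW.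
Qed.

(** The difference [u - v] lies below both [u] and [w], hence below their meet. *)
Lemma vle_add_disjoint u v w :
  u <=v v + w -> 0 <=v v -> u /\v w <=v 0 -> u <=v v.
Proof.
move=> uvw v0 uw; apply/vsubr_ge0; rewrite -opprB -oppr0; apply/vle_oppr.
apply: vle_tr uw; apply: vmeet_ge; apply/vle_subl_addr; last by rewrite addrC.
exact: vle_addl.
Qed.

(** The factor [1 + a] dominates both 1 and [a], and a common factor can be taken out of the
    meet. *)
Lemma vmeet_scale_le0 a u w :
  0 <= a -> 0 <=v u -> 0 <=v w -> u /\v w <=v 0 -> u /\v (a *: w) <=v 0.
Proof.
move=> a0 u0 w0 uw; have b0 : 0 < 1 + a by rewrite ltr_wpDr.
rewrite -(scaler0 _ (1 + a)); apply/vle_scalel => //; apply: vle_tr uw.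
apply: vmeet_ge; apply/vle_scalel => //.
  apply: (vle_tr (vle_meetl _ _)); rewrite -{1}[u]scale1r.
  by apply: vle_scaler => //; rewrite lerDl.
by apply: (vle_tr (vle_meetr _ _)); apply: vle_scaler => //; rewrite lerDr.
Qed.

(* With [x^+ \/ w] replaced by its two terms, the only nontrivial part is
   [2 (x /\ (w - x)) <= w]. *)
Lemma vmeet_grid_step x w : 0 <=v w ->
  (pos x \/v w) /\v abs (x - w) <=v pos (x - w) \/v w.
Proof.
move=> w0; rewrite vmeetC; apply: vmeet_distrW; last first.
  by apply: vle_tr (vle_meetr _ _) _; exact: vle_joinr.
rewrite vmeetC; apply: vmeet_distrW.
  apply: vle_tr (vle_meetr _ _) _; apply: vle_tr (vpos_ge _) _.
  exact: vle_joinl.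
rewrite opprB vmeetC; apply: vle_tr (vle_joinr _ _).
apply: vmeet_distrW; last exact: vle_tr (vle_meetr _ _) w0.
set t := _ /\v x.
have : t + t <=v w.
  by rewrite -[w](subrK x); apply: vle_add; [exact: vle_meetl|exact: vle_meetr].
have -> : t + t = (2 : R) *: t by rewrite scaler_nat mulr2n.
move=> tb; rewrite -[t]scale1r -(@mulVf _ (2 : R))// -scalerA.
apply/vle_scalel => //; apply: vle_tr tb _.
by rewrite -{1}[w]scale1r; apply: vle_scaler => //; rewrite ler1n.
Qed.

(* The grid [k x / n] is [x / n]-dense in [[0, M x]]. *)
Lemma vle_grid u x z (M : nat) : 0 <=v x -> z <=v M%:R *: x -> 0 <=v z ->
  (forall a, 0 <= a -> u <=v abs (z - a *: x)) -> u <=v 0.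
Proof.
move=> x0 zM z0 h; apply: (@vle_archi _ x) => n.
set d := n.+1%:R^-1 : R.
have d0 : 0 <= d by rewrite invr_ge0.
have dx0 : 0 <=v d *: x by exact: vle_scale_ge0.
have {}h k : u <=v pos (z - (k%:R * d) *: x) \/v (d *: x).
  elim: k => [|k IH].
    rewrite mul0r scale0r subr0; apply: vle_tr (vle_joinl _ _).
    apply: vle_tr (vpos_ge _); rewrite -(vabs_pos z0) -[z in abs z]subr0.
    by rewrite -(scale0r x); exact: h.
  have -> : z - (k.+1%:R * d) *: x = z - (k%:R * d) *: x - d *: x.
    by rewrite -addn1 natrD mulrDl mul1r scalerDl opprD addrA.
  apply: vle_tr (vmeet_grid_step _ dx0); apply: vmeet_ge => //.
  have -> : z - (k%:R * d) *: x - d *: x = z - (k.+1%:R * d) *: x.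
    by rewrite -addn1 natrD mulrDl mul1r scalerDl opprD addrA.
  by apply: h; rewrite mulr_ge0.
(* For [k = M (n + 1)] the grid point is [M x], which lies above [z]: the positive part vanishes and
   [u <= d x] remains. *)
have := h (M * n.+1)%N; rewrite natrM mulfK ?pnatr_eq0//.
rewrite [pos _]vjoin_idr; last by apply/vle_subl_addr; rewrite add0r.
by rewrite vjoin_idr.
Qed.

End VectorLattice.

(** * Lattice automorphisms and the center *)

Section LinearMaps.
Context {R : realType} {V W : lmodType R} (T : V -> W).
Hypothesis lT : linear T.

Lemma linop0 : T 0 = 0.
Proof. by have := lT (-1) 0 0; rewrite scaler0 addr0 scaleN1r addNr. Qed.

Lemma linopD x y : T (x + y) = T x + T y.
Proof. by rewrite -[x in LHS]scale1r lT scale1r. Qed.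

Lemma linopZ a x : T (a *: x) = a *: T x.
Proof. by rewrite -[a *: x]addr0 lT linop0 addr0. Qed.

Lemma linopN x : T (- x) = - T x.
Proof. by rewrite -scaleN1r linopZ scaleN1r. Qed.

Lemma linopB x y : T (x - y) = T x - T y.
Proof. by rewrite linopD linopN. Qed.

Lemma linop_sum (I : finType) (F : I -> V) : T (\sum_i F i) = \sum_i T (F i).
Proof. exact: (big_morph T linopD linop0). Qed.

End LinearMaps.

Section Automorphisms.
Context {R : realType} (E : banachLatticeType R).
Implicit Types (x y z u v w : E) (a b c : R) (f g m T : E -> E).

Local Notation "x <=v y" := (vle x y) (at level 70).
Local Notation "x /\v y" := (vmeet x y) (at level 48).
Local Notation pos x := (vjoin x 0).
Local Notation neg x := (vjoin (- x) 0).
Local Notation abs x := (vjoin x (- x)).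

Lemma positive_op_homo T x y : positive_op T -> x <=v y -> T x <=v T y.
Proof.
by move=> [lT pT] /vsubr_ge0 /pT; rewrite linopB// => /vsubr_ge0.
Qed.

Lemma positive_op_abs T x : positive_op T -> abs (T x) <=v T (abs x).
Proof.
move=> pT; apply: vabs_le; first exact/positive_op_homo/vabs_ge.
rewrite -(linopN pT.1); apply: positive_op_homo => //; exact: vle_joinr.
Qed.

Lemma linop_abs_le T c : linear T ->
  (forall x, 0 <=v x -> - (c *: x) <=v T x) ->
  (forall x, 0 <=v x -> T x <=v c *: x) -> forall x, abs (T x) <=v c *: abs x.
Proof.
move=> lT Tl Tu x; rewrite [abs x]vabsE scalerDr.
have -> : T x = T (pos x) - T (neg x) by rewrite -(linopB lT) vposBneg.
apply: vabs_le.
  apply: vle_add; first exact/Tu/vpos_ge0.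
  by rewrite -[c *: _]opprK; apply/vle_oppr/Tl/vpos_ge0.
rewrite opprB addrC; apply: vle_add; last exact/Tu/vpos_ge0.
by rewrite -[c *: _]opprK; apply/vle_oppr/Tl/vpos_ge0.
Qed.

(* In a representation on C(K) this says that (t^+ t) x = (t^+)^2 x >= 0.
   Here [u := (T z)^-] is disjoint from [(T x)^-], which forces
   [u <= c |z - a x|] for all [a >= 0], and [z <= c x]. *)
Lemma linop_vpos_ge0 T c x : linear T -> (forall y, abs (T y) <=v c *: abs y) ->
  0 <=v x -> 0 <=v T (pos (T x)).
Proof.
move=> lT; wlog c0 : c / 0 < c => [wlg Tc x0|Tc x0].
  apply: (wlg (`|c| + 1)); rewrite ?ltr_wpDl//.
  move=> y; apply: (vle_tr (Tc y)); apply: vle_scaler (vabs_ge0 _).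
  by rewrite (le_trans (ler_norm c))// lerDl.
set z := pos (T x); set w := neg (T x).
have z0 : 0 <=v z by exact: vpos_ge0.
have w0 : 0 <=v w by exact: vpos_ge0.
set u := neg (T z).
have u0 : 0 <=v u by exact: vpos_ge0.
suff : u <=v 0.
  move=> /(vle_tr (vpos_ge _)); rewrite -{1}oppr0.
  by move/vle_oppr.
have ucz : u <=v c *: z.
  apply: vle_tr (_ : abs (T z) <=v _); last by have := Tc z; rewrite (vabs_pos z0).
  by apply: vjoin_le; [exact: vle_joinr|exact: vabs_ge0].
have uw : u /\v w <=v 0.
  apply: (@vle_tr _ _ ((c *: z) /\v w)).
    by apply: vmeet_homo ucz _; exact: vle_refl.
  rewrite vmeetC; apply: vmeet_scale_le0 => //; rewrite ?ltW//.
  by rewrite vmeetC vpos_meet_neg; exact: vle_refl.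
have uza a : 0 <= a -> u <=v c *: abs (z - a *: x).
  move=> a0; apply: (@vle_add_disjoint _ _ _ _ (a *: w)).
  - apply: vjoin_le; last first.
      by apply: vaddr_ge0; apply: vle_scale_ge0 => //;
        [exact: ltW|exact: vabs_ge0].
    have -> : - T z = - T (z - a *: x) - a *: z + a *: w.
      have aTx : a *: T x = a *: z - a *: w by rewrite -scalerBr vposBneg.
      rewrite (linopB lT) (linopZ lT) aTx opprB -addrA [- (a *: z) + _]addrC.
      by rewrite -[a *: w - _]opprB addrAC subrr add0r.
    apply: vle_add; last exact: vle_refl.
    rewrite -[X in _ <=v X]subr0; apply: vle_add.
      by apply: vle_tr (Tc _); exact: vle_joinr.
    by apply/vle_oppr; exact: vle_scale_ge0.
  - by apply: vle_scale_ge0; [exact: ltW|exact: vabs_ge0].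
  - exact: vmeet_scale_le0.
have := @vle_grid _ _ (c^-1 *: u) x z (Num.truncn c).+1 x0 _ z0.
move=> h; rewrite -(scaler0 _ c); apply/vle_scalel => //; apply: h.
  apply: (@vle_tr _ _ (c *: x)); last first.
    by apply: vle_scaler => //; exact/ltW/truncnS_gt.
  apply: (vle_tr (vpos_le_abs _)); by have := Tc x; rewrite (vabs_pos x0).
by move=> a /uza ua; apply/vle_scalel.
Qed.

Lemma AutP_id : AutP E id.
Proof. by split=> //; exists id. Qed.

Lemma AutP_comp f g : AutP E f -> AutP E g -> AutP E (f \o g).
Proof.
move=> [lf bf jf mf] [lg bg jg mg]; split.
- by move=> a x y /=; rewrite lg lf.
- exact: bij_comp.
- by move=> x y /=; rewrite jg jf.
- by move=> x y /=; rewrite mg mf.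
Qed.

Lemma AutP_can f g : AutP E f -> cancel f g -> cancel g f -> AutP E g.
Proof.
move=> [lf bf jf mf] fg gf; split.
- by move=> a x y; rewrite -[x in LHS]gf -[y in LHS]gf -lf fg.
- by exists f.
- by move=> x y; rewrite -[x in LHS]gf -[y in LHS]gf -jf fg.
- by move=> x y; rewrite -[x in LHS]gf -[y in LHS]gf -mf fg.
Qed.

Lemma AutP_positive f : AutP E f -> positive_op f.
Proof.
move=> [lf _ jf _]; split=> // x x0.
by rewrite -(vjoin_idr x0) jf (linop0 lf); exact: vle_joinl.
Qed.

Lemma AutP_homo f x y : AutP E f -> x <=v y -> f x <=v f y.
Proof. by move=> /AutP_positive; exact: positive_op_homo. Qed.

Lemma pinvTK f : bijective f -> cancel (pinv setT f) f.
Proof.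
move=> [g fg gf] x; apply: (@surjpK _ _ (fun=> point) setT setT); rewrite ?in_setT//.
by move=> y _ /=; exists (g y).
Qed.

Lemma pinvTKV f : bijective f -> cancel f (pinv setT f).
Proof. by move=> bf x; apply: (bij_inj bf); rewrite pinvTK. Qed.

Lemma ZAutP_bound m :
  ZAutP E m <-> AutP E m /\ exists2 c, 0 <= c & forall x, 0 <=v x -> m x <=v c *: x.
Proof.
split=> [[am [_ [c [c0 _ mc]]]]|[am [c c0 mc]]]; first by split=> //; exists c.
have pm := AutP_positive am; split=> //; split.
  exists m, (fun=> 0); split=> // [|x]; last by rewrite subr0.
  split=> [a x y|x _]; [by rewrite scaler0 addr0|exact: vle_refl].
exists c; split=> // x x0; apply: (@vle_tr _ _ 0); last exact: pm.2.
by rewrite -oppr0; apply/vle_oppr; exact: vle_scale_ge0.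
Qed.

Lemma ZAutP_comp m m' : ZAutP E m -> ZAutP E m' -> ZAutP E (m \o m').
Proof.
move=> /ZAutP_bound[am [c c0 mc]] /ZAutP_bound[am' [c' c'0 mc']].
apply/ZAutP_bound; split; first exact: AutP_comp.
exists (c * c') => [|x x0 /=]; first exact: mulr_ge0.
apply: (vle_tr (mc _ _)); first exact: (AutP_positive am').2.
by rewrite -scalerA; apply: vle_scale => //; exact: mc'.
Qed.

Lemma ZAutP_conj m f g : ZAutP E m -> AutP E f -> cancel f g -> cancel g f ->
  ZAutP E (f \o m \o g).
Proof.
move=> /ZAutP_bound[am [c c0 mc]] af fg gf; have ag := AutP_can af fg gf.
apply/ZAutP_bound; split; first by apply: AutP_comp => //; exact: AutP_comp.
exists c => // x x0 /=; rewrite -[x in X in _ <=v X]gf.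
have [lf _ _ _] := af; rewrite -(linopZ lf); apply: AutP_homo => //.
by apply: mc; exact: (AutP_positive ag).2.
Qed.

(* With [T := 1 - b m] and [z := (T x)^+], [linop_vpos_ge0] gives [b m z <= z],
   so [z = 0] as soon as [b > c]. *)
Lemma ZAutP_can_le m n c : ZAutP E m -> cancel m n -> cancel n m -> 0 <= c ->
  (forall x, `|n x| <= c * `|x|) -> forall x, 0 <=v x -> n x <=v c *: x.
Proof.
move=> /ZAutP_bound[am [k k0 mk]] mn nm c0 nc.
have lm : linear m by case: am.
have pm := (AutP_positive am).2.
suff key x : 0 <=v x -> x <=v c *: m x.
  move=> x x0; rewrite -[x in c *: x]nm; apply: key.
  exact: (AutP_positive (AutP_can am mn nm)).2.
move=> x0; apply: vle_scale_closed => b cb.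
have b0 : 0 < b by exact: le_lt_trans cb.
pose T y := y - b *: m y.
have lT : linear T.
  move=> a y z; rewrite /T lm scalerBr scalerDr opprD !scalerA [b * a]mulrC.
  by rewrite addrACA.
have Tb y : abs (T y) <=v (1 + b * k) *: abs y.
  apply: (linop_abs_le lT) => {}y y0; rewrite scalerDl scale1r -scalerA.
    rewrite opprD; apply: vle_add.
      apply: (@vle_tr _ _ 0) => //; rewrite -oppr0; exact/vle_oppr.
    by apply/vle_oppr; apply: vle_scale; [exact: ltW|exact: mk].
  apply: vle_add; first exact: vle_refl.
  apply: (@vle_tr _ _ 0).
    rewrite -oppr0; apply/vle_oppr; apply: vle_scale_ge0; [exact: ltW|exact: pm].
  by apply: vle_scale_ge0; [exact: ltW|exact: vle_scale_ge0].
have := linop_vpos_ge0 lT Tb x0; set z := pos (T x) => Tz.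
have z0 : 0 <=v z by exact: vpos_ge0.
suff z00 : z = 0.
  apply/vsubr_ge0; rewrite -opprB -oppr0; apply/vle_oppr.
  by rewrite -[X in _ <=v X]z00; exact: vpos_ge.
have bz : b * `|m z| <= `|z|.
  rewrite -(gtr0_norm b0) -normrZ; apply: vnorm_le; last exact/vsubr_ge0.
  by apply: vle_scale_ge0; [exact: ltW|exact: pm].
have := nc (m z); rewrite mn => zc.
apply/eqP; rewrite -normr_eq0 -[_ == 0]negbK; apply/negP => z1.
have mz0 : 0 < `|m z|.
  rewrite lt_neqAle normr_ge0 andbT eq_sym normr_eq0; apply: contra z1 => /eqP mz.
  by rewrite -(mn z) mz (linop0 (T := n)) ?normr0//; case: (AutP_can am mn nm).
by have := le_trans bz zc; rewrite ler_pM2r// leNgt cb.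
Qed.

End Automorphisms.

(** * Factorization of central by isometric automorphisms *)

Section CentralAutomorphisms.
Context {R : realType} (E : banachLatticeType R).
Implicit Types (x y z u v w : E) (a b c : R) (f g m T phi : E -> E).

Local Notation "x <=v y" := (vle x y) (at level 70).
Local Notation "x \/v y" := (vjoin x y) (at level 50).
Local Notation "x /\v y" := (vmeet x y) (at level 48).
Local Notation pos x := (vjoin x 0).
Local Notation neg x := (vjoin (- x) 0).
Local Notation abs x := (vjoin x (- x)).

Lemma vsum_ge0 (I : Type) (r : seq I) (P : pred I) (F : I -> E) :
  (forall i, P i -> 0 <=v F i) -> 0 <=v \sum_(i <- r | P i) F i.
Proof.
by move=> F0; elim/big_rec: _ => [|i x Pi x0]; [exact: vle_refl|];
  apply: vaddr_ge0 => //; exact: F0.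
Qed.

(* Gliding hump: if [|T_n x_n| > 4^n |x_n|], the [T_n] are unbounded at
   [\sum_n 2^-n |x_n|^-1 abs x_n], which dominates each of its terms. *)
Lemma positive_ops_bounded (F : set (E -> E)) :
  (forall T, F T -> positive_op T) ->
  (forall x, exists M : R, forall T, F T -> `|T x| <= M) ->
  exists2 C : R, 0 <= C & forall T, F T -> forall x, `|T x| <= C * `|x|.
Proof.
move=> pF bF; apply: contrapT => nC.
have {nC} /choice[h hP] (n : nat) : exists h : (E -> E) * E,
    F h.1 /\ (4 ^+ n : R) * `|h.2| < `|h.1 h.2|.
  apply: contrapT => nh; apply: nC; exists (4 ^+ n); first by rewrite exprn_ge0.
  move=> T FT x; rewrite leNgt; apply/negP => lt.
  by apply: nh; exists (T, x).
pose t n := (h n).1; pose x n := (h n).2.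
have Ft n : F (t n) by case: (hP n).
have tx n : (4 ^+ n : R) * `|x n| < `|t n (x n)| by case: (hP n).
have x0 n : 0 < `|x n|.
  rewrite normr_gt0; apply/eqP => xn; have := tx n.
  by rewrite xn (linop0 (pF _ (Ft n)).1) normr0 mulr0 ltxx.
pose y n : E := (2 ^+ n * `|x n|)^-1 *: abs (x n).
have k0 n : 0 < (2 ^+ n * `|x n|)^-1 by rewrite invr_gt0 mulr_gt0// exprn_gt0.
have y0 n : 0 <=v y n by apply: vle_scale_ge0; [exact: ltW|exact: vabs_ge0].
have ny n : `|y n| = 2^-1 ^+ n.
  rewrite normrZ vnorm_abs gtr0_norm// invfM -mulrA mulVf ?gt_eqF// mulr1.
  by rewrite exprVn.
have ty n : 2 ^+ n < `|t n (y n)|.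
  have [lt pt] := pF _ (Ft n).
  rewrite (linopZ lt) normrZ gtr0_norm// mulrC ltr_pdivlMr ?mulr_gt0 ?exprn_gt0//.
  rewrite mulrA -exprMn -natrM; apply: lt_le_trans (tx n) _.
  apply: vnorm_abs_le; exact: positive_op_abs.
have cy : cvgn (series y).
  apply: normed_cvg; rewrite (_ : [normed series y] = series (geometric 1 2^-1)).
    by apply: is_cvg_geometric_series; rewrite ger0_norm// invf_lt1// ltr1n.
  by apply/funext => n; apply: eq_bigr => i _; rewrite /= ny mul1r.
have ys n : y n <=v limn (series y).
  apply: vle_closed => e e0.
  have /cvgrPdist_le/(_ e e0)[N _ hN] := cy.
  exists (series y (maxn N n.+1)); last first.
    by rewrite distrC; apply: hN; exact: leq_maxl.
  rewrite /series /= (big_cat_nat _ (n := n)) ?leq0n//=; last first.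
    by rewrite ltnW// leq_max ltnSn orbT.
  rewrite [\sum_(n <= _ < _) _]big_ltn ?leq_max ?ltnSn ?orbT// addrCA.
  by apply: vle_addl; apply: vaddr_ge0; apply: vsum_ge0.
have [M MP] := bF (limn (series y)).
pose n := (Num.truncn M).+1.
have : `|t n (y n)| <= M.
  apply: le_trans (MP _ (Ft n)); apply: vnorm_le.
    by apply: (pF _ (Ft n)).2.
  exact: positive_op_homo (pF _ (Ft n)) _.
rewrite leNgt => /negP; apply; apply: lt_trans (ty n); apply: lt_trans (truncnS_gt M) _.
by rewrite -natrX ltr_nat; exact: ltn_expl.
Qed.

Lemma positive_op_bounded T : positive_op T ->
  exists2 C : R, 0 <= C & forall x, `|T x| <= C * `|x|.
Proof.
move=> pT; have [||C C0 CP] := @positive_ops_bounded [set T].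
- by move=> _ ->.
- by move=> x; exists `|T x| => _ ->.
- by exists C => //; exact: CP.
Qed.

(** The inverse is a positive operator, hence norm bounded, and [ZAutP_can_le] turns the norm bound
    into an order bound. *)
Lemma ZAutP_can m n : ZAutP E m -> cancel m n -> cancel n m -> ZAutP E n.
Proof.
move=> zm mn nm; have an : AutP E n by apply: AutP_can mn nm; exact: zm.1.
have [c c0 nc] := positive_op_bounded (AutP_positive an).
apply/ZAutP_bound; split=> //; exists c => //; exact: (ZAutP_can_le zm mn nm).
Qed.

Lemma ZAutP_pinv m : ZAutP E m -> ZAutP E (pinv setT m).
Proof.
move=> zm; have bm : bijective m by case: zm.1.
by apply: (ZAutP_can zm); [exact: pinvTKV|exact: pinvTK].
Qed.

Lemma IAutP_comp f g : IAutP E f -> IAutP E g -> IAutP E (f \o g).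
Proof.
move=> [af nf] [ag ng]; split; first exact: AutP_comp.
by move=> x; rewrite /= nf ng.
Qed.

Lemma IAutP_can f g : IAutP E f -> cancel f g -> cancel g f -> IAutP E g.
Proof.
move=> [af nf] fg gf; split; first exact: AutP_can fg gf.
by move=> x; rewrite -[in RHS](gf x) nf.
Qed.

Lemma IAutP_pinv f : IAutP E f -> IAutP E (pinv setT f).
Proof.
move=> zf; have bf : bijective f by case: zf.1.
by apply: (IAutP_can zf); [exact: pinvTKV|exact: pinvTK].
Qed.

(** [ZAutP_can_le] with [c = 1] applies to [f] and to its inverse, so both lie below the identity on
    the cone. *)
Lemma ZAutP_IAutP_id f : ZAutP E f -> IAutP E f -> f = id.
Proof.
move=> zf isof; have bf : bijective f by case: zf.1.
have fK := pinvTK bf; have Kf := pinvTKV bf.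
have le1 g h : ZAutP E g -> IAutP E h -> cancel g h -> cancel h g ->
    forall x, 0 <=v x -> h x <=v x.
  move=> zg ih gh hg x x0; rewrite -[x in X in _ <=v X]scale1r.
  by apply: (ZAutP_can_le zg gh hg) => // y; rewrite mul1r ih.2.
have f1 x : 0 <=v x -> f x = x.
  move=> x0; apply: vle_anti.
    by apply: (le1 _ _ _ _ fK Kf) => //; exact: ZAutP_pinv.
  rewrite -[x in X in X <=v _]Kf; apply: (le1 _ _ _ _ Kf fK) => //.
    exact: IAutP_pinv.
  exact: (AutP_positive isof.1).2.
apply/funext => x; rewrite -[x in LHS]vposBneg linopB; last by case: isof.1.
by rewrite !f1 ?vposBneg//; exact: vpos_ge0.
Qed.

(** The quotient of [phi] by [phi'] equals that of [m'] by [m], so it is isometric and central at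
    once. *)
Lemma isometric_part_uniq m m' phi phi' : ZAutP E m -> ZAutP E m' ->
  IAutP E phi -> IAutP E phi' -> m \o phi = m' \o phi' -> phi = phi'.
Proof.
move=> zm zm' iphi iphi' e.
have bm : bijective m by case: zm.1.
have bphi' : bijective phi' by case: iphi'.1.
have ek : phi \o pinv setT phi' = pinv setT m \o m'.
  apply/funext => x /=; rewrite -[phi _](pinvTKV bm).
  by have /= -> := congr1 (@^~ (pinv setT phi' x)) e; rewrite pinvTK.
have k1 : phi \o pinv setT phi' = id.
  apply: ZAutP_IAutP_id; last by apply: IAutP_comp => //; exact: IAutP_pinv.
  by rewrite ek; apply: ZAutP_comp => //; exact: ZAutP_pinv.
apply/funext => x; rewrite -[x in LHS](pinvTKV bphi').
by have /= -> := congr1 (@^~ (phi' x)) k1.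
Qed.

Lemma isometric_part_comp m phi : ZAutP E m -> IAutP E phi ->
  isometric_part (m \o phi) = phi.
Proof.
move=> zm iphi; apply: xget_subset1; first by split=> //; exists m.
move=> psi psi' [ipsi [m1 zm1 e1]] [ipsi' [m2 zm2 e2]].
by apply: (isometric_part_uniq zm1 zm2) => //; rewrite -e1.
Qed.

Lemma ZIAutP_isometric_part f : ZIAutP E f -> IAutP E (isometric_part f) /\
  exists2 m, ZAutP E m & f = m \o isometric_part f.
Proof.
move=> [m [phi [zm iphi ->]]]; rewrite isometric_part_comp//; split=> //.
by exists m.
Qed.

(* [(m phi) (m' phi') = (m (phi m' phi^-1)) (phi phi')] *)
Lemma isometric_partM f g : ZIAutP E f -> ZIAutP E g ->
  isometric_part (f \o g) = isometric_part f \o isometric_part g.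
Proof.
move=> [m [phi [zm iphi ->]]] [m' [phi' [zm' iphi' ->]]].
have bphi : bijective phi by case: iphi.1.
rewrite (isometric_part_comp zm iphi) (isometric_part_comp zm' iphi').
have e : (m \o phi) \o (m' \o phi') =
    (m \o (phi \o m' \o pinv setT phi)) \o (phi \o phi').
  by apply/funext => x /=; rewrite pinvTKV.
apply: (etrans (congr1 (@isometric_part _ E) e)).
apply: isometric_part_comp; last exact: IAutP_comp.
apply: ZAutP_comp => //; apply: ZAutP_conj => //; first exact: iphi.1.
  exact: pinvTKV.
exact: pinvTK.
Qed.

Lemma ZIAutP_AutP f : ZIAutP E f -> AutP E f.
Proof.
by move=> [m [phi [zm iphi ->]]]; apply: AutP_comp; [exact: zm.1|exact: iphi.1].
Qed.

(** The images of the positive and negative parts of [x] lie below [b] times these parts, hence stay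
    disjoint; this makes [m] a lattice homomorphism. The lower bound by [a] gives bijectivity. *)
Lemma linop_between_ZAutP m a b : linear m -> 0 < a ->
  (forall x, 0 <=v x -> a *: x <=v m x) ->
  (forall x, 0 <=v x -> m x <=v b *: x) -> ZAutP E m.
Proof.
(* On the zero space the hypotheses do not constrain [b]. Replacing it by the maximum with [a] makes
   [b] positive and the contraction factor [q] below nonnegative. *)
move=> lm a0 ma; wlog ab : b / a <= b => [wlg mb|mb].
  apply: (wlg (Num.max a b)) => [|x x0]; first by rewrite le_max lexx.
  by apply: vle_tr (mb _ x0) _; apply: vle_scaler => //; rewrite le_max lexx orbT.
have b0 : 0 < b by exact: lt_le_trans ab.
have m_ge0 x : 0 <=v x -> 0 <=v m x.
  by move=> x0; apply: vle_tr (ma _ x0); apply: vle_scale_ge0 => //; exact: ltW.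
have m_pos x : m (pos x) = pos (m x).
  have disj : m (pos x) /\v m (neg x) = 0.
    apply: vle_anti; last by apply: vmeet_ge; apply: m_ge0; exact: vpos_ge0.
    apply: (@vle_tr _ _ (b *: pos x /\v b *: neg x)).
      by apply: vmeet_homo; apply: mb; exact: vpos_ge0.
    apply: vmeet_scale_le0; rewrite ?(ltW b0)//.
    - by apply: vle_scale_ge0; [exact: ltW|exact: vpos_ge0].
    - exact: vpos_ge0.
    rewrite vmeetC; apply: vmeet_scale_le0; rewrite ?(ltW b0)//;
      do ?exact: vpos_ge0.
    by rewrite vmeetC vpos_meet_neg; exact: vle_refl.
  have := vjoinDmeet (m (pos x)) (m (neg x)); rewrite disj addr0 => jE.
  rewrite -[x in RHS]vposBneg (linopB lm).
  have -> : pos (m (pos x) - m (neg x)) = (m (pos x) \/v m (neg x)) - m (neg x).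
    by rewrite vjoinDr subrr.
  by rewrite jE addrK.
have m_join : {morph m : x y / x \/v y}.
  move=> x y; have e u v : u \/v v = pos (u - v) + v by rewrite vjoinDr subrK add0r.
  by rewrite e [in RHS]e (linopD lm) m_pos (linopB lm).
have m_meet : {morph m : x y / x /\v y}.
  by move=> x y; rewrite !vmeetE (linopN lm) m_join !(linopN lm).
(* On the cone [T = 1 - m / b] lies between 0 and [q = 1 - a / b < 1], so it contracts the norm by
   [q]. This gives injectivity, and [m x = y] is solved by the fixed point of [T x + y / b]. *)
pose q := 1 - a / b; pose T x := x - b^-1 *: m x.
have lT : linear T.
  move=> c x y; rewrite /T lm scalerBr scalerDr opprD !scalerA [b^-1 * c]mulrC.
  by rewrite addrACA.
have q1 : q < 1 by rewrite ltrBlDr ltrDl divr_gt0.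
have q0 : 0 <= q by rewrite subr_ge0 ler_pdivrMr// mul1r.
have nT x : `|T x| <= q * `|x|.
  rewrite -(ger0_norm q0) -(vnorm_abs x) -normrZ; apply: vnorm_abs_le.
  apply: (linop_abs_le lT) => {}x x0.
    apply: (@vle_tr _ _ 0); first by rewrite -oppr0; apply/vle_oppr/vle_scale_ge0.
    by apply/vsubr_ge0/vle_scalel => //; exact: mb.
  rewrite scalerBl scale1r; apply: vle_add; first exact: vle_refl.
  apply/vle_oppr; rewrite mulrC -scalerA; apply: vle_scale; last exact: ma.
  by rewrite invr_ge0 ltW.
have injm : injective m.
  move=> x y mxy; apply/eqP; rewrite -subr_eq0 -normr_eq0; apply/negPn/negP => nxy.
  have : T (x - y) = x - y by rewrite /T (linopB lm) mxy subrr scaler0 subr0.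
  have := nT (x - y) => /[swap] ->; rewrite -[leLHS]mul1r ler_pM2r.
    by rewrite leNgt q1.
  by rewrite lt_neqAle eq_sym nxy normr_ge0.
have surjm y : exists x, m x = y.
  pose F x := T x + b^-1 *: y.
  pose S := isFun.Build E E setT setT F (fun _ _ => Logic.I).
  pose F' : {fun [set: E] >-> [set: E]} := HB.pack F S.
  have cF : is_contraction F'.
    exists (NngNum q0); split=> //= -[u v] _ /=.
    by rewrite /F opprD addrACA subrr addr0 -(linopB lT) nT.
  have [||x _ xE] := @banach_fixed_point _ _ _ F' cF; first exact: closedT.
    by exists 0.
  exists x; move: xE => /= xE; apply: (@scalerI _ _ b^-1).
    by rewrite invr_eq0 gt_eqF.
  move/eqP: xE; rewrite /F /T -addrA -[X in X == _]addr0 (inj_eq (addrI _)).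
  by rewrite eq_sym addrC subr_eq0 => /eqP.
apply/ZAutP_bound; split; last by exists b => //; exact: ltW.
split=> //; have [g gP] := choice surjm; exists g => // x.
by apply: injm; rewrite gP.
Qed.

End CentralAutomorphisms.

(** * Invariant means of vector-valued functions *)

Section FiniteMean.
Context {R : realType} {V : normedModType R}.

Definition fmean (I : finType) (F : I -> V) : V := (#|I|%:R : R)^-1 *: \sum_i F i.

Lemma card_inv_gt0 (I : finType) (i0 : I) : (0 : R) < #|I|%:R^-1.
Proof. by rewrite invr_gt0 ltr0n; apply/card_gt0P; exists i0. Qed.

Lemma norm_fmean_le (I : finType) (F : I -> V) (e : R) :
  0 <= e -> (forall i, `|F i| <= e) -> `|fmean F| <= e.
Proof.
move=> e0 Fe; have [i0 _|I0] := pickP I; last first.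
  by rewrite /fmean big1 ?scaler0 ?normr0// => i; have := I0 i.
have I0 := card_inv_gt0 i0.
rewrite normrZ gtr0_norm// mulrC ler_pdivrMr; last by rewrite -invr_gt0.
apply: le_trans (ler_norm_sum _ _ _) _.
by apply: le_trans (ler_sum _ (fun i _ => Fe i)) _; rewrite sumr_const mulr_natr.
Qed.

Lemma fmean_cst (I : finType) (i0 : I) (c : V) : fmean (fun _ : I => c) = c.
Proof.
rewrite /fmean sumr_const -[c *+ _]scaler_nat scalerA mulVf ?scale1r//.
by rewrite gt_eqF// -invr_gt0 card_inv_gt0.
Qed.

Lemma fmeanB (I : finType) (F H : I -> V) :
  fmean F - fmean H = fmean (fun i => F i - H i).
Proof. by rewrite /fmean -scalerBr sumrB. Qed.

Lemma fmeanD (I : finType) (F H : I -> V) :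
  fmean F + fmean H = fmean (fun i => F i + H i).
Proof. by rewrite /fmean -scalerDr big_split. Qed.

Lemma fmeanZ (I : finType) (F : I -> V) (a : R) :
  a *: fmean F = fmean (fun i => a *: F i).
Proof. by rewrite /fmean -scaler_sumr !scalerA mulrC. Qed.

Lemma eq_fmean (I : finType) (F H : I -> V) : F =1 H -> fmean F = fmean H.
Proof. by move=> FH; rewrite /fmean (eq_bigr _ (fun i _ => FH i)). Qed.

Lemma norm_fmean_sub_le (I : finType) (i0 : I) (F : I -> V) (c : V) (e : R) :
  (forall i, `|F i - c| <= e) -> `|fmean F - c| <= e.
Proof.
move=> Fc; rewrite -[c in X in X <= _](fmean_cst i0) fmeanB.
by apply: norm_fmean_le => //; apply: le_trans (Fc i0).
Qed.

Lemma fmean_pair (I J : finType) (F : I -> J -> V) :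
  fmean (fun p : I * J => F p.1 p.2) = fmean (fun i => fmean (F i)).
Proof.
by rewrite /fmean -scaler_sumr scalerA card_prod natrM invfM pair_bigA.
Qed.

Lemma fmean_exchange (I J : finType) (F : I -> J -> V) :
  fmean (fun i => fmean (F i)) = fmean (fun j => fmean (F^~ j)).
Proof. by rewrite /fmean -!scaler_sumr !scalerA mulrC exchange_big. Qed.

Lemma fmean_perm (I : finType) (s : {perm I}) (F : I -> V) :
  fmean (F \o s) = fmean F.
Proof. by rewrite /fmean [in RHS](reindex_inj (@perm_inj _ s)). Qed.

End FiniteMean.

(** * Right averages and the decay of their oscillation *)

Section RightMean.
Context {R : realType} {V : normedModType R} {T : Type} (op : T -> T -> T).
Variable G : set T.
Implicit Types (f : T -> V) (c : V) (d e : R).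

(** Families may repeat points, so iterated averages are again averages with uniform weights
    ([ravg_pair]). *)
Definition ravg (I : finType) (k : I -> T) f : T -> V :=
  fun g => fmean (fun i => f (op g (k i))).

(** The inhabitant of [I] excludes the empty average, whose value is 0. The bound is uniform over
    [G], which is what makes right means invariant under left translation. *)
Definition rapprox f e c := exists (I : finType) (_ : I) (k : I -> T),
  (forall i, G (k i)) /\ forall g, G g -> `|ravg k f g - c| <= e.

Definition rmean f c := forall e, 0 < e -> rapprox f e c.

(* Total boundedness of [G] for the bi-invariant pseudometric
   [sup_(a, b) |f (a g b) - f (a h b)|]. *)
Definition bitb f := forall e, 0 < e -> exists (I : finType) (k : I -> T),
  (forall i, G (k i)) /\ forall g, G g -> exists i, forall a b, G a -> G b ->
    `|f (op (op a g) b) - f (op (op a (k i)) b)| <= e.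

Definition rosc f d := exists (I : finType) (_ : I) (k : I -> T),
  (forall i, G (k i)) /\
  forall g h, G g -> G h -> `|ravg k f g - ravg k f h| <= d.

Lemma rapproxW f c c' d e :
  rapprox f d c -> `|c - c'| <= e -> rapprox f (d + e) c'.
Proof.
move=> [I [i0 [k [Gk kP]]]] cc'; exists I, i0, k; split=> // g Gg.
rewrite -[ravg _ _ _](subrK c) -addrA.
by apply: le_trans (ler_normD _ _) _; apply: lerD => //; exact: kP.
Qed.

Hypothesis opA : associative op.
Hypothesis G_op : forall g h, G g -> G h -> G (op g h).
Hypothesis G_div : forall g h, G g -> G h -> exists2 k, G k & op g k = h.

Lemma ravg_pair (I J : finType) (k : I -> T) (l : J -> T) f g :
  ravg (fun p : I * J => op (k p.1) (l p.2)) f g = ravg k (ravg l f) g.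
Proof.
rewrite /ravg -(@fmean_pair _ _ _ _ (fun i j => f (op (op g (k i)) (l j)))).
by apply: eq_fmean => p; rewrite opA.
Qed.

Lemma bitb_ravg (J : finType) (j0 : J) (l : J -> T) f :
  (forall j, G (l j)) -> bitb f -> bitb (ravg l f).
Proof.
move=> Gl tf e e0; have [I [k [Gk kP]]] := tf e e0; exists I, k; split=> // g Gg.
have [i iP] := kP g Gg; exists i => a b Ga Gb; rewrite /ravg fmeanB.
apply: norm_fmean_le => [|j]; first exact: ltW.
by rewrite -![op (op _ b) _]opA; apply: iP => //; exact: G_op.
Qed.

(** Up to [e], the averages over the net at [g] and at [h] share a term: take [x] in [G] with
    [g x = h k_i0] and a net point [k_i1] near [x]. A transposition matches these two terms; each of
    the other [n - 1] pairs costs at most [e + d]. *)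
Lemma rosc_step f (I : finType) (k : I -> T) e d : (forall i, G (k i)) ->
  (forall g, G g -> exists i, forall a b, G a -> G b ->
    `|f (op (op a g) b) - f (op (op a (k i)) b)| <= e) ->
  G !=set0 -> 0 <= e -> 0 <= d ->
  rosc f (e + d) -> rosc f (e + (1 - #|I|%:R^-1) * d).
Proof.
move=> Gk kP [g0 Gg0] e0 d0 [J [j0 [l [Gl lP]]]].
have [i0 _] := kP _ Gg0; have I0 := card_inv_gt0 (R := R) i0.
exists (I * J)%type, (i0, j0), (fun p => op (k p.1) (l p.2)); split.
  by move=> [i j]; exact: G_op.
move=> g h Gg Gh; rewrite !ravg_pair; set phi := ravg l f.
have [x Gx gx] := G_div Gg (G_op Gh (Gk i0)).
have [i1 i1P] := kP x Gx.
have near_i1 : `|phi (op g (k i1)) - phi (op h (k i0))| <= e.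
  rewrite distrC -gx /phi /ravg fmeanB; apply: norm_fmean_le => // j.
  exact: i1P.
pose s := tperm i1 i0.
rewrite {1}/ravg /ravg -(fmean_perm s (fun i => phi (op h (k i)))) fmeanB /=.
rewrite /fmean normrZ gtr0_norm//.
have -> : e + (1 - #|I|%:R^-1) * d = #|I|%:R^-1 * (e + (e + d) *+ #|I|.-1).
  have cI : (0 < #|I|)%N by apply/card_gt0P; exists i0.
  rewrite -{1 2}(prednK cI) -[(e + d) *+ _]mulr_natr -natr1.
  have : (#|I|.-1%:R + 1 : R) != 0 by rewrite natr1 pnatr_eq0.
  by move: (#|I|.-1%:R : R) => n nI; field.
apply: ler_wpM2l; first exact: ltW.
rewrite (bigD1 i1)//=; apply: le_trans (ler_normD _ _) _; apply: lerD.
  by rewrite /s tpermL.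
apply: le_trans (ler_norm_sum _ _ _) _.
apply: (@le_trans _ _ (\sum_(i | i != i1) (e + d))).
  by apply: ler_sum => i _; apply: lP; exact: G_op.
by rewrite sumr_const cardC1.
Qed.

Lemma bitb_rosc f e : G !=set0 -> bitb f -> 0 < e -> rosc f e.
Proof.
move=> G0 tf e0; have e20 : 0 < e / 2 by rewrite divr_gt0.
have [g0 Gg0] := G0.
have [I [k [Gk kP]]] := tf _ e20.
have [i0 _] := kP _ Gg0; have I0 := card_inv_gt0 (R := R) i0.
(* Some oscillation bound is needed to start the iteration. A net of mesh 1 bounds [f] on the
   translate [G g0], which is all that the average over the single point [g0] sees; since [bitb]
   controls only values at products [a g b], the net points also appear between two factors [g0]. *)
have [D D0 fD] : exists2 D, 0 <= D & rosc f D.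
  have [J [l [Gl lP]]] := tf 1 ltr01.
  pose B : R := 1 + \sum_j `|f (op (op g0 (l j)) g0)|.
  have fB g : G g -> `|f (op g g0)| <= B.
    move=> Gg; have [x Gx <-] := G_div Gg0 Gg; have [j jP] := lP x Gx.
    rewrite -[f _](subrK (f (op (op g0 (l j)) g0))).
    apply: le_trans (ler_normD _ _) _; apply: lerD; first exact: jP.
    by rewrite (bigD1 j)//= lerDl sumr_ge0.
  exists (B + B); first by rewrite addr_ge0// (le_trans _ (fB g0 Gg0)).
  exists unit, tt, (fun=> g0); split=> // g h Gg Gh.
  rewrite /ravg !(fmean_cst tt).
  by apply: le_trans (ler_normB _ _) _; apply: lerD; exact: fB.
pose q : R := 1 - #|I|%:R^-1.
have q0 : 0 <= q.
  rewrite subr_ge0 invf_le1 ?ler1n; last by rewrite -invr_gt0.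
  by apply/card_gt0P; exists i0.
have q1 : q < 1 by rewrite ltrBlDr ltrDl.
have step j : rosc f (e / 2 + q ^+ j * D).
  elim: j => [|j IH].
    rewrite expr0 mul1r; case: fD => J [j0 [l [Gl lP]]].
    exists J, j0, l; split=> // g h Gg Gh; apply: le_trans (lP _ _ Gg Gh) _.
    by rewrite lerDr ltW.
  rewrite exprS -mulrA; apply: (rosc_step Gk kP) => //; first exact: ltW.
  by rewrite mulr_ge0// exprn_ge0.
have [j qj] : exists j, q ^+ j * D <= e / 2.
  have : (geometric D q @ \oo --> (0 : R))%classic.
    by apply: cvg_geometric; rewrite ger0_norm.
  move=> /cvgrPdist_le/(_ _ e20)[j _ /(_ j (leqnn j))] /=.
  rewrite sub0r normrN ger0_norm; first by rewrite mulrC; exists j.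
  by rewrite mulr_ge0// exprn_ge0.
case: (step j) => J [j0 [l [Gl lP]]]; exists J, j0, l; split=> // g h Gg Gh.
apply: le_trans (lP _ _ Gg Gh) _.
by rewrite [leRHS](splitr e) lerD2l.
Qed.

Lemma bitb_rapprox f e : G !=set0 -> bitb f -> 0 < e -> exists c, rapprox f e c.
Proof.
move=> G0 tf e0; have [J [j0 [l [Gl lP]]]] := bitb_rosc G0 tf e0.
by have [g Gg] := G0; exists (ravg l f g), J, j0, l; split=> // h Gh; exact: lP.
Qed.

Lemma rmean_translate f c g : G g -> rmean f c -> rmean (f \o op g) c.
Proof.
move=> Gg fc e /fc[I [i0 [k [Gk kP]]]]; exists I, i0, k; split=> // h Gh.
have -> : ravg k (f \o op g) h = ravg k f (op g h).
  by apply: eq_fmean => i /=; rewrite opA.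
by apply: kP; exact: G_op.
Qed.

Lemma rmean_point f c e : G !=set0 -> rmean f c -> 0 < e ->
  exists (I : finType) (_ : I) (k : I -> T),
    (forall i, G (k i)) /\ `|fmean (f \o k) - c| <= e.
Proof.
move=> [g Gg] fc /fc[I [i0 [k [Gk kP]]]]; exists I, i0, (fun i => op g (k i)).
by split=> [i|]; [exact: G_op|exact: kP].
Qed.

End RightMean.

(** * Two-sided means: existence, uniqueness, linearity *)

Section Mean.
Context {R : realType} {V : completeNormedModType R} {T : Type}.
Context (op : T -> T -> T) (G : set T).
Implicit Types (f : T -> V) (c : V) (d e : R).

Local Notation flip := (fun g h => op h g).

Hypothesis opA : associative op.
Hypothesis G0 : G !=set0.
Hypothesis G_op : forall g h, G g -> G h -> G (op g h).
Hypothesis G_divr : forall g h, G g -> G h -> exists2 k, G k & op g k = h.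
Hypothesis G_divl : forall g h, G g -> G h -> exists2 k, G k & op k g = h.

Let flipA : associative flip.
Proof. by move=> x y z; rewrite opA. Qed.

Let G_flip g h : G g -> G h -> G (flip g h).
Proof. by move=> Gg Gh; exact: G_op. Qed.

(** Two-sided translates in [bitb] make the condition pass to the opposite product, whose right
    means are the left means. *)
Lemma bitb_flip f : bitb op G f -> bitb flip G f.
Proof.
move=> tf e /tf[I [k [Gk kP]]]; exists I, k; split=> // g /kP[i iP].
by exists i => a b Ga Gb; rewrite !opA; exact: iP.
Qed.

(* Average over [g = l j * k i] in both orders. *)
Lemma rapprox_flip_dist f c c' d e :
  rapprox op G f d c -> rapprox flip G f e c' -> `|c - c'| <= d + e.
Proof.
move=> [I [i0 [k [Gk kP]]]] [J [j0 [l [Gl lP]]]].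
pose s := fmean (fun j => fmean (fun i => f (op (l j) (k i)))).
rewrite -[c](subrK s) -addrA; apply: le_trans (ler_normD _ _) _; apply: lerD.
  by rewrite distrC; apply: norm_fmean_sub_le => // j; exact: kP.
rewrite /s fmean_exchange.
by apply: norm_fmean_sub_le => // i; exact: lP.
Qed.

Lemma rmean_flip_eq f c c' : rmean op G f c -> rmean flip G f c' -> c = c'.
Proof.
move=> fc fc'; apply/eqP; rewrite -subr_eq0 -normr_le0.
apply/ler_addgt0Pr => e e0; rewrite add0r [leRHS]splitr.
by apply: rapprox_flip_dist; [apply: fc|apply: fc']; rewrite divr_gt0.
Qed.

(** Approximate right means are not compared with each other directly. Each is close to every
    approximate left mean, so the sequence [u] is Cauchy and [v] has the same limit. *)
Lemma mean_exists f : bitb op G f ->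
  exists c, rmean op G f c /\ rmean flip G f c.
Proof.
move=> tf; have half e : 0 < e -> 0 < e / 2 by move=> e0; rewrite divr_gt0.
have quarter e : 0 < e -> 0 < e / 4 by move=> e0; rewrite divr_gt0.
have [w w0 small] : exists2 w : nat -> R, forall n, 0 < w n &
    forall e, 0 < e -> exists N, forall n, (N <= n)%N -> w n <= e.
  exists (fun n => n.+1%:R^-1) => [n|e e0]; first by rewrite invr_gt0.
  exists (Num.truncn e^-1) => n Nn.
  rewrite -[e]invrK lef_pV2 ?posrE ?invr_gt0//.
  by apply: le_trans (ltW (truncnS_gt _)) _; rewrite ler_nat ltnS.
have /choice[u uP] (n : nat) : exists u, rapprox op G f (w n) u.
  by apply: bitb_rapprox => //; exact: G_divr.
have /choice[v vP] (n : nat) : exists v, rapprox flip G f (w n) v.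
  by apply: (bitb_rapprox flipA G_flip G_divl) => //; exact: bitb_flip.
have uv n m : `|u n - v m| <= w n + w m.
  exact: rapprox_flip_dist (uP n) (vP m).
have uu e : 0 < e -> exists N, forall n m, (N <= n)%N -> (N <= m)%N ->
    `|u n - u m| <= e.
  (* Passing through [v m] costs [w n + w m] and then [w m + w m]: four terms, hence the quarter. *)
  move=> e0; have [N NP] := small _ (quarter _ e0).
  exists N => n m Nn Nm; rewrite -[u n](subrK (v m)) -addrA.
  apply: le_trans (ler_normD _ _) _; rewrite [X in _ + X]distrC.
  apply: le_trans (lerD (uv _ _) (uv _ _)) _.
  have := NP n Nn; have := NP m Nm; lra.
have cu : cvgn u.
  apply/cauchy_cvgP/cauchy_exP => e e0.
  have [N NP] := uu _ (half _ e0).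
  exists (u N); exists N => // n /= Nn; rewrite -ball_normE /=.
  by apply: le_lt_trans (NP N n _ _) _ => //; lra.
pose c := limn u.
have uc e : 0 < e -> exists N, forall n, (N <= n)%N -> `|u n - c| <= e.
  move=> e0; have /cvgrPdist_le/(_ e e0)[N _ NP] := cu.
  by exists N => n Nn; rewrite distrC; exact: NP.
exists c; split=> e e0.
  have [N NP] := small _ (half _ e0).
  have [M MP] := uc _ (half _ e0).
  pose n := maxn N M; rewrite [e](_ : _ = (e - w n) + w n); last lra.
  rewrite addrC; apply: rapproxW (uP n) _.
  have := NP n (leq_maxl _ _); have := MP n (leq_maxr _ _); lra.
have [N NP] := small _ (quarter _ e0).
have [M MP] := uc _ (quarter _ e0).
pose n := maxn N M; rewrite [e](_ : _ = w n + (e - w n)); last lra.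
apply: rapproxW (vP n) _; rewrite -[v n](subrK (u n)) -addrA.
apply: le_trans (ler_normD _ _) _; rewrite distrC.
have := uv n n; have := NP n (leq_maxl _ _); have := MP n (leq_maxr _ _); lra.
Qed.

(** Every right mean equals the left mean supplied by [mean_exists]. *)
Lemma rmean_uniq f c c' : bitb op G f ->
  rmean op G f c -> rmean op G f c' -> c = c'.
Proof.
move=> /mean_exists[d [_ fd]] fc fc'.
by rewrite (rmean_flip_eq fc fd) (rmean_flip_eq fc' fd).
Qed.

(* Averaging [f'] by the weights that are good for [f] does not change its left
   mean, hence not its right mean; averaging once more then serves both. *)
Lemma rapprox_pair f f' c c' d e : bitb op G f' -> 0 < e ->
  rapprox op G f d c -> rmean op G f' c' ->
  exists (I : finType) (_ : I) (k : I -> T), (forall i, G (k i)) /\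
    forall g, G g -> `|ravg op k f g - c| <= d /\ `|ravg op k f' g - c'| <= e.
Proof.
move=> tf' e0 [I [i0 [k [Gk kP]]]] fc'.
have [c1 [fc1 fc1']] := mean_exists tf'.
have kf'c' : rmean flip G (ravg op k f') c'.
  rewrite (rmean_uniq tf' fc' fc1) => e1 /fc1'[J [j0 [l [Gl lP]]]].
  exists J, j0, l; split=> // g Gg.
  rewrite /ravg fmean_exchange; apply: norm_fmean_sub_le => // i.
  have := lP (op g (k i)) (G_op Gg (Gk i)); rewrite /ravg.
  by under eq_fmean do rewrite opA.
have tkf' : bitb op G (ravg op k f') by exact: bitb_ravg.
have [c2 [kc2 kc2']] := mean_exists tkf'.
have {}kc2 : rmean op G (ravg op k f') c'.
  by rewrite -(rmean_flip_eq kc2 kf'c').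
have [J [j0 [l [Gl lP]]]] := kc2 _ e0.
exists (J * I)%type, (j0, i0), (fun p => op (l p.1) (k p.2)); split.
  by move=> p; exact: G_op.
move=> g Gg; rewrite !(ravg_pair opA); split; last exact: lP.
by apply: norm_fmean_sub_le => // j; apply: kP; exact: G_op.
Qed.

(** Weights good for [f] need not be good for [f']; [rapprox_pair] supplies common ones. *)
Lemma rmean_linear f f' c c' (a : R) : bitb op G f' ->
  rmean op G f c -> rmean op G f' c' ->
  rmean op G (fun g => a *: f g + f' g) (a *: c + c').
Proof.
move=> tf' fc fc' e e0.
have a0 : 0 < `|a| + 1 by rewrite ltr_wpDl.
have e2 : 0 < e / 2 by rewrite divr_gt0.
have := rapprox_pair tf' e2 (fc _ (divr_gt0 e2 a0)) fc'.
move=> [I [i0 [k [Gk kP]]]]; exists I, i0, k; split=> // g /kP[fk f'k].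
have -> : ravg op k (fun h => a *: f h + f' h) g = a *: ravg op k f g + ravg op k f' g.
  by rewrite /ravg fmeanZ fmeanD.
rewrite opprD addrACA -scalerBr [e]splitr.
apply: le_trans (ler_normD _ _) _; apply: lerD => //; rewrite normrZ.
apply: le_trans (ler_wpM2l (normr_ge0 _) fk) _.
by rewrite mulrA ler_pdivrMr// mulrC ler_wpM2l ?(ltW e2)// lerDl.
Qed.

End Mean.

Lemma rmean_linop (R : realType) (V W : normedModType R) (T : Type)
    (op : T -> T -> T) (G : set T) (L : V -> W) (C : R) (f : T -> V) (c : V) :
  linear L -> 0 <= C -> (forall x, `|L x| <= C * `|x|) ->
  rmean op G f c -> rmean op G (L \o f) (L c).
Proof.
move=> lL C0 LC fc e e0.
have C1 : 0 < C + 1 by rewrite ltr_wpDl.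
have [I [i0 [k [Gk kP]]]] := fc _ (divr_gt0 e0 C1).
exists I, i0, k; split=> // g /kP gP.
have -> : ravg op k (L \o f) g = L (ravg op k f g).
  by rewrite /ravg /fmean (linopZ lL) (linop_sum lL).
rewrite -(linopB lL); apply: le_trans (LC _) _.
apply: le_trans (ler_wpM2l C0 gP) _.
by rewrite mulrA ler_pdivrMr// mulrC ler_wpM2l ?(ltW e0)// lerDl.
Qed.

(** * The mean of the central parts of a compact group *)

Section Compactness.
Context {R : realType}.

Lemma compact_net (T : topologicalType) (K : set T) (U : T -> set T) :
  compact K -> (forall k, K k -> \forall g \near k, K g -> U k g) ->
  exists (I : finType) (k : I -> T), (forall i, K (k i)) /\
    forall g, K g -> exists i, U (k i) g.
Proof.
move=> /compact_near_coveringP/near_covering_withinP cK KU.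
(* Along this filter a finite sequence eventually contains any given point. The near-covering
   property then exchanges quantifiers: [P s g] for large [s], locally in [g], becomes one [s] for
   all [g] in [K]. *)
pose F := filter_from [set: seq T] (fun s => [set t : seq T | {subset s <= t}]).
pose P (s : seq T) g := exists2 k, k \in s & K k /\ U k g.
have FF : Filter F.
  apply: filter_from_filter; first by exists [::].
  move=> s t _ _; exists (s ++ t) => // u stu.
  by split=> x xs; apply: stu; rewrite mem_cat xs ?orbT.
have [k Kk|s _ sP] := cK _ F P FF.
  exists ([set g | K g -> U k g], [set t : seq T | {subset [:: k] <= t}]).
    by split; [exact: KU|exists [:: k]].
  move=> [g t] [/= gU kt] Kg; exists k; last by split=> //; exact: gU.
  by apply: kt; rewrite mem_head.
pose r := [seq k <- s | k \in K].
exists (seq_sub r), (@ssval _ r); split=> [i|g Kg].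
  by have := ssvalP i; rewrite mem_filter => /andP[/set_mem].
have [k ks [Kk Ukg]] := sP s (fun _ => id) g Kg.
have kr : k \in r by rewrite mem_filter ks andbT mem_set.
by exists (SeqSub kr).
Qed.

Lemma ptws_eval_continuous (T : topologicalType) (V : uniformType) (x : T) :
  continuous (fun h : {ptws T -> V} => h x).
Proof. exact: (@proj_continuous T (fun=> V) x). Qed.

Lemma ptws_continuous (S T : topologicalType) (V : uniformType)
    (f : S -> {ptws T -> V}) :
  (forall x, continuous (fun h => f h x)) -> continuous f.
Proof. by move=> fc h; apply/pointwise_cvgP => x; exact: (fc x h). Qed.

Lemma linop_continuous (V : normedModType R) (T : V -> V) (C : R) :
  linear T -> (forall x, `|T x| <= C * `|x|) -> continuous T.
Proof.
move=> lT TC x; apply/cvgrPdist_le => e e0.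
have C1 : 0 < `|C| + 1 by rewrite ltr_wpDl.
near=> y; rewrite -(linopB lT); apply: le_trans (TC _) _.
apply: (@le_trans _ _ ((`|C| + 1) * `|x - y|)).
  by apply: ler_wpM2r => //; rewrite (le_trans (ler_norm C))// lerDl.
rewrite -ler_pdivlMl// mulrC; near: y.
by apply: cvgr_dist_le; rewrite // divr_gt0.
Unshelve. all: by end_near. Qed.

End Compactness.

(** * The pointwise mean as an operator *)

Section MeanOperator.
Context {R : realType} (E : banachLatticeType R) (G : set (E -> E)).
Context (q : (E -> E) -> (E -> E)) (C : R).
Implicit Types (x y : E) (e : R) (g h k : E -> E) (W : set E).

Hypothesis C1 : 1 <= C.
Hypothesis G_lin : forall g, G g -> linear g.
Hypothesis G_bound : forall g, G g -> forall x, `|g x| <= C * `|x|.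
Hypothesis G_id : G id.
Hypothesis G_comp : forall g h, G g -> G h -> G (g \o h).
Hypothesis G_inv : forall g, G g -> exists2 h, G h & cancel g h /\ cancel h g.
Hypothesis q_lin : forall g, G g -> linear (q g).
Hypothesis q_iso : forall g, G g -> forall x, `|q g x| = `|x|.
Hypothesis q_comp : forall g h, G g -> G h -> q (g \o h) = q h \o q g.
Hypothesis G_net : forall (J : finType) (w : J -> E) e, 0 < e ->
  exists (I : finType) (k : I -> E -> E), (forall i, G (k i)) /\
    forall g, G g -> exists i, forall j,
      `|g (w j) - k i (w j)| <= e /\ `|q g (w j) - q (k i) (w j)| <= e.

Let C0 : 0 < C. Proof. exact: lt_le_trans C1. Qed.

Definition totally_bounded_set W := forall e, 0 < e ->
  exists (J : finType) (w : J -> E), forall v, W v -> exists j, `|v - w j| <= e.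

Lemma G_net_set W e : totally_bounded_set W -> 0 < e ->
  exists (I : finType) (k : I -> E -> E), (forall i, G (k i)) /\
    forall g, G g -> exists i, forall v, W v ->
      `|g v - k i v| <= e /\ `|q g v - q (k i) v| <= e.
Proof.
(* The three terms of the estimate cost [C d], [d] and [C d], each at most [C d] because
   [1 <= C]. *)
move=> tW e0; pose d := e / (3 * C).
have d0 : 0 < d by rewrite divr_gt0// mulr_gt0.
have [J [w wP]] := tW _ d0; have [I [k [Gk kP]]] := G_net w d0.
exists I, k; split=> // g Gg; have [i iP] := kP g Gg; exists i => v Wv.
have [j jP] := wP v Wv; have [ij1 ij2] := iP j.
have dE : C * d + d + C * d <= e.
  have -> : e = 3 * C * d by rewrite mulrC divfK// gt_eqF// mulr_gt0.
  have : d <= C * d by rewrite ler_peMl// ltW.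
  lra.
have cmp (a b : E -> E) : linear a -> linear b ->
    (forall x, `|a x| <= C * `|x|) -> (forall x, `|b x| <= C * `|x|) ->
    `|a (w j) - b (w j)| <= d -> `|a v - b v| <= e.
  move=> la lb aC bC ab; apply: le_trans dE.
  have -> : a v - b v = a (v - w j) + (a (w j) - b (w j)) + b (w j - v).
    by rewrite (linopB la) (linopB lb) !addrA !subrK.
  apply: le_trans (ler_normD _ _) _; apply: lerD.
    apply: le_trans (ler_normD _ _) _; apply: lerD => //.
    by apply: le_trans (aC _) _; rewrite ler_pM2l.
  by apply: le_trans (bC _) _; rewrite ler_pM2l// distrC.
have qC h : G h -> forall x, `|q h x| <= C * `|x|.
  by move=> Gh x; rewrite q_iso// ler_peMl.
by split; apply: cmp => //; do ?[exact: G_lin|exact: q_lin|exact: G_bound|exact: qC].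
Qed.

(** In the application [q g] is the inverse of the isometric part of [g], so that [q] reverses
    products and this vector is the central part of [g] applied to [x]. *)
Definition central_orbit x g : E := g (q g x).

Lemma totally_bounded_orbit x :
  totally_bounded_set [set y | exists2 a, G a & y = q a x].
Proof.
move=> e e0; have [I [k [Gk kP]]] := G_net (fun _ : unit => x) e0.
exists I, (fun i => q (k i) x) => _ [a Ga ->].
by have [i /(_ tt)[_ iP]] := kP a Ga; exists i.
Qed.

(** Points of this form are those at which [bitb_central_orbit] compares [g] with its net point. *)
Lemma totally_bounded_orbit2 x : totally_bounded_set
  [set y | exists a b, [/\ G a, G b & y = b (q a x)]].
Proof.
move=> e e0; have tY := totally_bounded_orbit x.
have e2 : 0 < e / 2 by rewrite divr_gt0.
have [I [k [Gk kP]]] := G_net_set tY e2.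
have [J [w wP]] := tY _ (divr_gt0 e2 C0).
exists (I * J)%type, (fun u => k u.1 (w u.2)) => _ [a [b [Ga Gb ->]]].
have Ya : exists2 a', G a' & q a x = q a' x by exists a.
have [i /(_ _ Ya)[iP _]] := kP b Gb; have [j jP] := wP _ Ya.
exists (i, j) => /=; rewrite -[b _](subrK (k i (q a x))) -addrA [e]splitr.
apply: le_trans (ler_normD _ _) _; apply: lerD => //.
rewrite -(linopB (G_lin (Gk i))); apply: le_trans (G_bound (Gk i) _) _.
by rewrite -ler_pdivlMl// mulrC.
Qed.

Lemma totally_bounded_setU W W' : totally_bounded_set W ->
  totally_bounded_set W' -> totally_bounded_set (W `|` W').
Proof.
move=> tW tW' e e0; have [J [w wP]] := tW e e0; have [J' [w' wP']] := tW' e e0.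
exists (J + J')%type, (fun s => match s with inl j => w j | inr j => w' j end).
by move=> v [/wP[j]|/wP'[j]] jP; [exists (inl j)|exists (inr j)].
Qed.

(* [f (a g b) = a (g (b (q b (q g y))))] with [y = q a x], so replacing [g] by [k]
   only involves [g - k] at [b (q (a g b) x)] and [q g - q k] at [y]. *)
Lemma bitb_central_orbit x : bitb (@comp E E E) G (central_orbit x).
Proof.
(* The error of [g - k i] is magnified by [a] only, that of [q g - q (k i)] by [a], [k i] and [b];
   both factors are at most [C ^+ 3], and each error gets half of [e]. *)
move=> e e0; pose d := e / (2 * C ^+ 3).
have d0 : 0 < d by rewrite divr_gt0// mulr_gt0// exprn_gt0.
have tW := totally_bounded_setU (totally_bounded_orbit x) (totally_bounded_orbit2 x).
have [I [k [Gk kP]]] := G_net_set tW d0.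
exists I, k; split=> // g Gg; have [i iP] := kP g Gg; exists i => a b Ga Gb.
have Gki := Gk i.
have qE h : G h -> q ((a \o h) \o b) = q b \o (q h \o q a).
  by move=> Gh; rewrite (q_comp (G_comp Ga Gh) Gb) (q_comp Ga Gh).
rewrite /central_orbit (qE _ Gg) (qE _ Gki) /=.
set y := q a x.
have [_ qgk] : `|g y - k i y| <= d /\ `|q g y - q (k i) y| <= d.
  by apply: iP; left; exists a.
have [gk _] : `|g (b (q b (q g y))) - k i (b (q b (q g y)))| <= d /\
    `|q g (b (q b (q g y))) - q (k i) (b (q b (q g y)))| <= d.
  apply: iP; right; exists ((a \o g) \o b), b; split=> //.
    by do 2![apply: G_comp => //].
  by rewrite (qE _ Gg).
rewrite -(linopB (G_lin Ga)).
apply: le_trans (G_bound Ga _) _.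
rewrite -[g _](subrK (k i (b (q b (q g y))))) -addrA -(linopB (G_lin Gki)).
rewrite -(linopB (G_lin Gb)) -(linopB (q_lin Gb)).
have eE : e = C * (C ^+ 2 * d + C ^+ 2 * d).
  by rewrite /d; field; rewrite gt_eqF.
rewrite eE ler_pM2l//; apply: le_trans (ler_normD _ _) _; apply: lerD.
  apply: le_trans gk _; rewrite ler_peMl ?(ltW d0)//.
  exact: exprn_ege1.
apply: le_trans (G_bound Gki _) _; rewrite expr2 -mulrA ler_pM2l//.
by apply: le_trans (G_bound Gb _) _; rewrite ler_pM2l// q_iso.
Qed.

Local Notation rmeanG := (rmean (@comp E E E) G).

Let G0 : G !=set0. Proof. by exists id. Qed.

Let G_divr g h : G g -> G h -> exists2 k, G k & g \o k = h.
Proof.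
move=> Gg Gh; have [g' Gg' [_ g'K]] := G_inv Gg.
by exists (g' \o h); [exact: G_comp|apply/funext => x /=; rewrite g'K].
Qed.

Let G_divl g h : G g -> G h -> exists2 k, G k & k \o g = h.
Proof.
move=> Gg Gh; have [g' Gg' [gK _]] := G_inv Gg.
by exists (h \o g'); [exact: G_comp|apply/funext => x /=; rewrite gK].
Qed.

Let compEA : associative (@comp E E E). Proof. by []. Qed.

(** [mean_opP] rules out the default value 0, and [mean_op_eq] any dependence on the choice. *)
Definition mean_op x : E := xget 0 [set c | rmeanG (central_orbit x) c].

Lemma mean_opP x : rmeanG (central_orbit x) (mean_op x).
Proof.
have [c [xc _]] := mean_exists compEA G0 G_comp G_divr G_divl
  (bitb_central_orbit x).
by apply: (@xgetPex _ 0 [set c | rmeanG (central_orbit x) c]); exists c.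
Qed.

Lemma mean_op_eq x c : rmeanG (central_orbit x) c -> mean_op x = c.
Proof.
exact: (rmean_uniq compEA G0 G_comp G_divr G_divl (bitb_central_orbit x)
  (mean_opP x)).
Qed.

Lemma mean_op_linear : linear mean_op.
Proof.
move=> a x y; apply: mean_op_eq.
have := rmean_linear compEA G0 G_comp G_divr G_divl a (bitb_central_orbit y)
  (mean_opP x) (mean_opP y).
move=> h e /h[I [i0 [k [Gk kP]]]]; exists I, i0, k; split=> // g Gg.
have -> : ravg (@comp E E E) k (central_orbit (a *: x + y)) g = ravg (@comp E E E) k
    (fun g => a *: central_orbit x g + central_orbit y g) g; last exact: kP.
apply: eq_fmean => i; have Ggk : G (g \o k i) by exact: G_comp.
by rewrite /central_orbit (q_lin Ggk) (G_lin Ggk).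
Qed.

Lemma mean_op_commute g x : G g -> g (mean_op (q g x)) = mean_op x.
Proof.
move=> Gg; have tx := bitb_central_orbit x.
have tgx : bitb (@comp E E E) G (central_orbit x \o comp g).
  move=> e /tx[I [k [Gk kP]]]; exists I, k; split=> // h /kP[i iP].
  by exists i => a b Ga Gb; apply: (iP (g \o a) b) => //; exact: G_comp.
(* Both vectors are right means of the left translate by [g] of the orbit map; [q_comp] identifies
   this translate with [g \o central_orbit (q g x)]. *)
apply: (rmean_uniq compEA G0 G_comp G_divr G_divl tgx); last first.
  exact: (rmean_translate compEA G_comp Gg (mean_opP x)).
have := rmean_linop (G_lin Gg) (ltW C0) (G_bound Gg) (mean_opP (q g x)).
move=> h e /h[I [i0 [k [Gk kP]]]]; exists I, i0, k; split=> // u Gu.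
have -> : ravg (@comp E E E) k (central_orbit x \o comp g) u =
    ravg (@comp E E E) k (g \o central_orbit (q g x)) u; last exact: kP.
apply: eq_fmean => i; have Guk : G (u \o k i) by exact: G_comp.
by rewrite /central_orbit /= q_comp.
Qed.

(** This reduces order bounds on [mean_op x] to properties stable under finite means; [vle_closed]
    and [vle_closedl] then pass to the limit. *)
Lemma fmean_closed (P : set E) x :
  (forall (I : finType) (_ : I) (F : I -> E), (forall i, P (F i)) -> P (fmean F)) ->
  (forall g, G g -> P (central_orbit x g)) ->
  forall e, 0 < e -> exists2 v, P v & `|v - mean_op x| <= e.
Proof.
move=> PF Px e e0.
have [I [i0 [k [Gk kP]]]] := rmean_point G_comp G0 (mean_opP x) e0.
by exists (fmean (central_orbit x \o k)) => //; apply: PF => // i; exact: Px.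
Qed.

Lemma mean_op_ge x y : (forall g, G g -> vle y (central_orbit x g)) ->
  vle y (mean_op x).
Proof.
move=> yx; apply: vle_closed; apply: (@fmean_closed (vle y)) => // I i0 F yF.
apply/vsubr_ge0; rewrite -[y](fmean_cst i0) fmeanB.
apply: vle_scale_ge0; first by rewrite ltW// (card_inv_gt0 i0).
by apply: vsum_ge0 => i _; apply/vsubr_ge0.
Qed.

Lemma mean_op_le x y : (forall g, G g -> vle (central_orbit x g) y) ->
  vle (mean_op x) y.
Proof.
move=> xy; apply: vle_closedl; apply: (@fmean_closed (vle^~ y)) => // I i0 F Fy.
apply/vsubr_ge0; rewrite -[y](fmean_cst i0) fmeanB.
apply: vle_scale_ge0; first by rewrite ltW// (card_inv_gt0 i0).
by apply: vsum_ge0 => i _; apply/vsubr_ge0.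
Qed.

End MeanOperator.

(** * Compact groups *)

Section CompactGroup.
Context {R : realType} (E : banachLatticeType R) (G : set (E -> E)).
Hypothesis cG : compact_subgroup G (ZIAutP E).
Implicit Types (x y : E) (g h m : E -> E).

Let p g : E -> E := isometric_part g.
Let q g : E -> E := pinv setT (p g).

Let G_id : G id. Proof. by case: cG => -[]. Qed.

Let G_comp g h : G g -> G h -> G (g \o h).
Proof. by case: cG => -[_ + _] _ _; exact. Qed.

Let G_inv g : G g -> exists2 h, G h & cancel g h /\ cancel h g.
Proof. by case: cG => -[_ _ +] _ _; exact. Qed.

Let G_ZI g : G g -> ZIAutP E g. Proof. by case: cG => _ + _; exact. Qed.

Let G_aut g : G g -> AutP E g. Proof. by move=> /G_ZI/ZIAutP_AutP. Qed.

Let G_lin g : G g -> linear g. Proof. by move=> /G_aut[]. Qed.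

Let p_iaut g : G g -> IAutP E (p g).
Proof. by move=> /G_ZI/ZIAutP_isometric_part[]. Qed.

Let p_bij g : G g -> bijective (p g). Proof. by move=> /p_iaut[[]]. Qed.

Let q_iaut g : G g -> IAutP E (q g). Proof. by move=> /p_iaut/IAutP_pinv. Qed.

Let pK g : G g -> cancel (p g) (q g). Proof. by move=> /p_bij/pinvTKV. Qed.

Let qK g : G g -> cancel (q g) (p g). Proof. by move=> /p_bij/pinvTK. Qed.

Let p_comp g h : G g -> G h -> p (g \o h) = p g \o p h.
Proof. by move=> /G_ZI Gg /G_ZI Gh; exact: isometric_partM. Qed.

Let q_comp g h : G g -> G h -> q (g \o h) = q h \o q g.
Proof.
move=> Gg Gh; apply/funext => x /=.
rewrite -{1}(qK Gg x) -{1}(qK Gh (q g x)).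
have -> y : p g (p h y) = p (g \o h) y by rewrite (p_comp Gg Gh).
by rewrite pK//; exact: G_comp.
Qed.

Lemma isometric_part_id : isometric_part (id : E -> E) = id.
Proof.
apply: (@isometric_part_comp _ _ id id); last first.
  by split=> //; exact: AutP_id.
apply/ZAutP_bound; split; first exact: AutP_id.
by exists 1 => // x _; rewrite scale1r; exact: vle_refl.
Qed.

Lemma group_of_maps_isometric_part : group_of_maps [set p g | g in G].
Proof.
split; first by exists id => //; exact: isometric_part_id.
  move=> _ _ [g Gg <-] [h Gh <-]; exists (g \o h); first exact: G_comp.
  exact: p_comp.
move=> _ [g Gg <-]; have [h Gh [gh hg]] := G_inv Gg.
exists (p h); first by exists h.
have pid g' h' : G g' -> G h' -> cancel h' g' -> cancel (p h') (p g').
  move=> Gg' Gh' gh' x; have /= := congr1 (@^~ x) (p_comp Gg' Gh').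
  have -> : g' \o h' = id by apply/funext => y /=; rewrite gh'.
  by rewrite /p isometric_part_id.
by split; exact: pid.
Qed.

(** Evaluation at [x] is continuous, so a finite net bounds each orbit, and [positive_ops_bounded]
    makes the bound uniform. *)
Lemma compact_group_bound : exists2 C : R, 1 <= C &
  forall g, G g -> forall x, `|g x| <= C * `|x|.
Proof.
have [||C C0 CP] := @positive_ops_bounded _ _ G.
- by move=> g /G_aut/AutP_positive.
- move=> x; have [_ _ cptG] := cG.
  have [|I [k [Gk kP]]] := @compact_net {ptws E -> E} G
      (fun k => [set g | `|k x - g x| <= 1]) cptG.
    move=> k _; have /cvgrPdist_le/(_ 1 ltr01) := @ptws_eval_continuous E E x k.
    by apply: filterS => g gk _.
  exists (1 + \sum_i `|k i x|) => g /kP[i /= iP].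
  rewrite -[g x](subrK (k i x)); apply: le_trans (ler_normD _ _) _.
  by apply: lerD; rewrite 1?distrC// (bigD1 i)//= lerDl sumr_ge0.
(* A constant at least 1 also serves as a bound for the isometries [q g]. *)
exists (C + 1) => [|g Gg x]; first by rewrite lerDr.
by apply: le_trans (CP g Gg x) _; rewrite ler_wpM2r// lerDl.
Qed.

Hypothesis p_continuous :
  {within (G : set {ptws E -> E}), continuous (@isometric_part R E)}.

Lemma compact_isometric_part : compact_subgroup [set p g | g in G] (IAutP E).
Proof.
split; first exact: group_of_maps_isometric_part.
  by move=> _ [g Gg <-]; exact: p_iaut.
by case: cG => _ _; exact: continuous_compact.
Qed.

(** Assumption (A) concerns [p], not its inverse [q]. With [y = q k (w j)], the isometry [q g] sends
    [p k y - p g y] to [q g (w j) - q k (w j)], so continuity of [p] at [y] suffices. *)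
Lemma compact_group_net (J : finType) (w : J -> E) (e : R) : 0 < e ->
  exists (I : finType) (k : I -> E -> E), (forall i, G (k i)) /\
    forall g, G g -> exists i, forall j,
      `|g (w j) - k i (w j)| <= e /\ `|q g (w j) - q (k i) (w j)| <= e.
Proof.
move=> e0; have [_ _ cptG] := cG.
apply: (@compact_net {ptws E -> E} G (fun k => [set g | forall j,
  `|g (w j) - k (w j)| <= e /\ `|q g (w j) - q k (w j)| <= e]) cptG).
move=> k Gk.
pose P j g := G g -> `|g (w j) - k (w j)| <= e /\ `|q g (w j) - q k (w j)| <= e.
have FF := @nbhs_filter {ptws E -> E} k.
suff kj j : \forall g \near (k : {ptws E -> E}), P j g.
  by apply: (@filterS _ _ FF) (filter_forall FF kj) => g gP Gg j; exact: gP.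
have A : \forall g \near (k : {ptws E -> E}), `|k (w j) - g (w j)| <= e.
  have /cvgrPdist_le := @ptws_eval_continuous E E (w j) k.
  exact.
set y := q k (w j).
have B : \forall g \near (k : {ptws E -> E}), G g -> `|p k y - p g y| <= e.
  have /subspace_continuousP/(_ k Gk) pc := p_continuous.
  have /cvgrPdist_le/(_ e e0) :=
    cvg_comp _ _ pc (@ptws_eval_continuous E E y (isometric_part k)).
  exact.
apply: (@filterS2 _ _ FF _ _ _ _ A B) => g gA gB Gg; rewrite distrC; split=> //.
have [[lq _ _ _] isoq] := q_iaut Gg.
have wE : w j = p k y by rewrite /y qK.
rewrite -/y wE -{2}(pK Gg y).
by rewrite -(linopB lq) isoq; exact: gB.
Qed.

Lemma compact_group_conj : exists2 m, ZAutP E m & G = conj_set m [set p g | g in G].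
Proof.
have [C C1 GC] := compact_group_bound.
have C0 : 0 < C by exact: lt_le_trans C1.
have q_lin g : G g -> linear (q g) by move=> /q_iaut[[]].
have q_iso g : G g -> forall x, `|q g x| = `|x| by move=> /q_iaut[].
pose m := mean_op G q.
have mlin : linear m.
  by apply: (mean_op_linear C1) => //; exact: compact_group_net.
have mcomm g x : G g -> g (m (q g x)) = m x.
  by move=> Gg; apply: (mean_op_commute C1) => //; exact: compact_group_net.
(* [g (q g _)] is the central part of [g] *)
have orbit_bounds g x : G g -> vle 0 x ->
    vle (C^-1 *: x) (central_orbit q x g) /\ vle (central_orbit q x g) (C *: x).
  move=> Gg x0; have [h Gh [gh hg]] := G_inv Gg.
  have [_ [c zc cE]] := ZIAutP_isometric_part (G_ZI Gg).
  have zgq : ZAutP E (g \o q g).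
    suff -> : g \o q g = c by [].
    by apply/funext => y /=; rewrite {1}cE /= -/(p g) qK.
  have K1 : cancel (g \o q g) (p g \o h) by move=> y /=; rewrite gh qK.
  have K2 : cancel (p g \o h) (g \o q g) by move=> y /=; rewrite pK.
  (* [ZAutP_can_le] converts norm bounds into order bounds: the one on [g] gives the upper estimate,
     and the one on its inverse [h], which is also in [G], gives the lower. *)
  split; last first.
    have zph := ZAutP_can zgq K1 K2.
    apply: (ZAutP_can_le zph K2 K1 (ltW C0)) => // y /=.
    by rewrite -[in leRHS](q_iso _ Gg y); exact: GC.
  apply/vle_scalel => //; rewrite -[x in X in vle X _]K1.
  apply: (ZAutP_can_le zgq K1 K2 (ltW C0)) => // [y|].
    by rewrite /= (p_iaut Gg).2; exact: GC.
  by apply: (AutP_positive zgq.1).2.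
have zm : ZAutP E m.
  apply: (@linop_between_ZAutP _ _ m C^-1 C) => //; first by rewrite invr_gt0.
    move=> x x0; apply: (mean_op_ge C1) => //; first exact: compact_group_net.
    by move=> g Gg; have [] := orbit_bounds g x Gg x0.
  move=> x x0; apply: (mean_op_le C1) => //; first exact: compact_group_net.
  by move=> g Gg; have [] := orbit_bounds g x Gg x0.
have bm : bijective m by case: zm.1.
have gE g : G g -> m \o p g \o pinv setT m = g.
  by move=> Gg; apply/funext => x /=; rewrite -(mcomm g _ Gg) pK// pinvTK.
exists m => //; apply/seteqP; split=> [g Gg|_ [_ [g Gg <-] <-]].
  by exists (p g); [exists g|exact: gE].
by rewrite gE.
Qed.

End CompactGroup.

(** * Conjugation by a central automorphism *)

Section Conjugation.
Context {R : realType} (E : banachLatticeType R) (m : E -> E).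
Hypothesis zm : ZAutP E m.
Implicit Types (g h : E -> E) (H : set (E -> E)).

Let mB : bijective m. Proof. by case: zm.1. Qed.
Let mK := pinvTKV mB.
Let Km := pinvTK mB.

(* [m h m^-1 = (m (h m^-1 h^-1)) h] *)
Lemma conj_IAutP h : IAutP E h -> exists2 m', ZAutP E m' &
  m \o h \o pinv setT m = m' \o h.
Proof.
move=> ih; have bh : bijective h by case: ih.1.
exists (m \o (h \o pinv setT m \o pinv setT h)).
  apply: ZAutP_comp => //; apply: ZAutP_conj; first exact: ZAutP_pinv.
  - exact: ih.1.
  - exact: pinvTKV.
  - exact: pinvTK.
by apply/funext => x /=; rewrite pinvTKV.
Qed.

Lemma isometric_part_conj h : IAutP E h ->
  isometric_part (m \o h \o pinv setT m) = h.
Proof.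
move=> ih; have [m' zm' e] := conj_IAutP ih.
exact: (etrans (congr1 (@isometric_part _ E) e) (isometric_part_comp zm' ih)).
Qed.

Lemma conj_set_compact H : compact_subgroup H (IAutP E) ->
  compact_subgroup (conj_set m H) (ZIAutP E).
Proof.
move=> [[Hid Hcomp Hinv] HI cH]; split.
- split.
  + by exists id => //; apply/funext => x /=; rewrite Km.
  + move=> _ _ [g Hg <-] [h Hh <-]; exists (g \o h); first exact: Hcomp.
    by apply/funext => x /=; rewrite mK.
  + move=> _ [g Hg <-]; have [h Hh [gh hg]] := Hinv g Hg.
    exists (m \o h \o pinv setT m); first by exists h.
    by split=> x /=; rewrite mK ?gh ?hg Km.
- move=> _ [h /HI ih <-]; have [m' zm' ->] := conj_IAutP ih.
  by exists m', h.
(* Conjugation is continuous for pointwise convergence: at [x] it is evaluation at the preimage of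
   [x] under [m], followed by [m], which is bounded as a positive operator. *)
- pose F (h : {ptws E -> E}) : {ptws E -> E} := m \o h \o pinv setT m.
  have [c c0 mc] := positive_op_bounded (AutP_positive zm.1).
  have [lm _ _ _] := zm.1.
  apply: (@continuous_compact {ptws E -> E} {ptws E -> E} F H) => //.
  apply: continuous_subspaceT; apply: ptws_continuous => x h.
  apply: (@continuous_comp _ _ _ (fun h : {ptws E -> E} => h (pinv setT m x)) m).
    exact: ptws_eval_continuous.
  exact: (linop_continuous lm mc).
Qed.

Lemma isometric_part_conj_set H : H `<=` IAutP E ->
  [set (isometric_part g : E -> E) | g in conj_set m H] = H.
Proof.
move=> HI; apply/seteqP; split=> [_ [_ [h Hh <-] <-]|h Hh].
  by rewrite isometric_part_conj//; exact: HI.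
exists (m \o h \o pinv setT m); first by exists h.
by rewrite isometric_part_conj//; exact: HI.
Qed.

End Conjugation.

Theorem theorem3p8 (R : realType) (E : banachLatticeType R) :
  assumptionA E ->
  (forall G : set (E -> E), compact_subgroup G (ZIAutP E) ->
     exists! H : set (E -> E), compact_subgroup H (IAutP E) /\
       exists2 m : E -> E, ZAutP E m & G = conj_set m H) /\
  (forall (H : set (E -> E)) (m : E -> E),
     compact_subgroup H (IAutP E) -> ZAutP E m ->
     compact_subgroup (conj_set m H) (ZIAutP E)).
Proof.
move=> hA; split=> [G cG|H m cH zm]; last exact: conj_set_compact.
exists [set (isometric_part g : E -> E) | g in G]; split.
  split; first exact: compact_isometric_part cG (hA G cG).
  exact: compact_group_conj cG (hA G cG).
move=> H [[_ HI _] [m zm ->]]; exact: isometric_part_conj_set.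
Qed.
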